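(* Let $G$ be a sub-$\mathbb F_q$-vector space of $C$. Then: (1) the definition of $\mathcal G$ does not depend on the choice of $r>0$; (2) $G$ has a descending basis if and only if $G\in\mathcal G$; (3) if $G\in\mathcal G$, then $G$ is locally compact; (4) if $G$ is discrete, then $G\in\mathcal G$ if and only if $G$ is finite or countable, with its elements tending to infinity in the countable case; (5) if $G$ is compact, then $G\in\mathcal G$ if and only if $\int_Gv=+\infty$ (with respect to Haar measure on $G$); (6) if $G\in\mathcal G$, then every closed sub-$\mathbb F_q$-vector space $H$ of $G$ also belongs to $\mathcal G$.
   Context: Let $q$ be a prime power and $C$ an algebraically closed field containing $\mathbb F_q$, complete with respect to a non-archimedean absolute value $|\cdot|$; $v(z)=-\log|z|$ ($v(0)=+\infty$), $\Delta_r=\{x\in C:|x|\le r\}$. For a real $r>0$, $\mathcal G$ (defined using $r$) is the collection of sub-$\mathbb F_q$-vector spaces $G\subseteq C$ such that: (i) $G\cap\Delta_r$ is compact; (ii) $\int_{G\cap\Delta_r}v=+\infty$ with respect to a Haar measure on $G\cap\Delta_r$; (iii) $G\cap\Delta_r$ has finite or countable index in $G$, and in the countable case any system of coset representatives $g_1,g_2,\dots$ satisfies $|g_n|\to+\infty$. A descending basis of $G$ is a family $\{\lambda_n\}_{n\in\mathbb Z}$ of elements of $C$, possibly terminating on either side, such that: (a) the $\lambda_n$ are $\mathbb F_q$-linearly independent and the closure of their span is $G$; (b) for each $m$ for which $\lambda_m$ exists, $\lambda_m$ is a smallest (in absolute value) nonzero element of the $\mathbb F_q$-span of $\{\lambda_n:n\le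 m\}$; (c) the family terminates on the left or $|\lambda_n|\to\infty$ as $n\to-\infty$; (d) the family terminates on the right or $\sum_{n=1}^\infty v(\lambda_n)q^{-n}=+\infty$. *)

(* Defs.v *)
From HB Require Import structures.
From mathcomp Require Import all_boot all_order all_algebra.
From mathcomp Require Import all_classical all_reals all_analysis.

Set Implicit Arguments.
Unset Strict Implicit.
Unset Printing Implicit Defensive.

Import Order.TTheory GRing.Theory Num.Theory.
Import numFieldNormedType.Exports.

Local Open Scope classical_set_scope.
Local Open Scope ring_scope.

(* The trivial absolute value is allowed. *)
Record nonarch_absval (R : realType) (C : fieldType) := NonarchAbsval {
  absval_fun :> C -> R;
  absval_ge0 : forall x, 0 <= absval_fun x;
  absval_eq0 : forall x, (absval_fun x == 0) = (x == 0);
  absvalM : forall x y, absval_fun (x * y) = absval_fun x * absval_fun y;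
  absvalD : forall x y,
    absval_fun (x + y) <= Num.max (absval_fun x) (absval_fun y)
}.

(* The field C, carrying the metric topology of the absolute value a. *)
Definition valued (R : realType) (C : fieldType) (a : nonarch_absval R C)
  : Type := C.

HB.instance Definition _ (R : realType) (C : fieldType)
    (a : nonarch_absval R C) := GRing.Field.copy (valued a) C.
HB.instance Definition _ (R : realType) (C : fieldType)
    (a : nonarch_absval R C) := isPointed.Build (valued a) 0.

Section ValuedMetric.
Variables (R : realType) (C : fieldType) (a : nonarch_absval R C).

Definition absv (x : valued a) : R := a x.

Definition absv_dist (x y : valued a) : R := absv (x - y).

Lemma absv0 : absv 0 = 0.
Proof. by apply/eqP; rewrite absval_eq0. Qed.

Lemma absv1 : absv 1 = 1.
Proof.
have n0 : absv 1 != 0 by rewrite absval_eq0 oner_neq0.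
by apply: (mulfI n0); rewrite -absvalM !mulr1.
Qed.

Lemma absvN (x : valued a) : absv (- x) = absv x.
Proof.
have h : absv (-1) = 1.
  apply/eqP; rewrite -(@eqrXn2 _ 2) ?absval_ge0 ?ler01// expr2 -absvalM.
  by rewrite mulrNN mulr1 expr1n; apply/eqP/absv1.
by rewrite -mulN1r /absv absvalM -/(absv (-1)) h mul1r.
Qed.

Lemma absv_distxx x : absv_dist x x = 0.
Proof. by rewrite /absv_dist subrr absv0. Qed.

Lemma absv_dist_positivity x y : absv_dist x y = 0 -> x = y.
Proof. by move/eqP; rewrite absval_eq0 subr_eq0 => /eqP. Qed.

Lemma absv_dist_sym x y : absv_dist x y = absv_dist y x.
Proof. by rewrite /absv_dist -absvN opprB. Qed.

Lemma absv_dist_triangle y x z :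
  absv_dist x z <= absv_dist x y + absv_dist y z.
Proof.
rewrite /absv_dist -[x - z](subrKA y).
apply: (le_trans (absvalD _ _ _)).
by rewrite ge_max lerDl lerDr !absval_ge0.
Qed.

HB.instance Definition _ := @isMetric.Build R (valued a) absv_dist
  absv_distxx absv_dist_positivity absv_dist_sym absv_dist_triangle.

Definition is_complete : Prop :=
  forall Phi : set_system (valued a), ProperFilter Phi -> cauchy Phi -> cvg Phi.

End ValuedMetric.

Section Valuation.
Context {R : realType} {C : fieldType} {a : nonarch_absval R C}.
Local Notation Ca := (valued a).

(* [lne 0%:E = -oo], so that [valuation 0 = +oo]. *)
Definition valuation (z : Ca) : \bar R := (- lne (absv z)%:E)%E.

Definition Delta (r : R) : set Ca := [set x | absv x <= r].

Definition tends_to_infty (g : nat -> Ca) : Prop :=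
  absv (g n) @[n --> \oo] --> +oo.

Definition borel : measurableType _ := g_sigma_algebraType (@open Ca).

(* Haar measure on a compact additive subgroup K: a nonzero, finite, translation
   invariant Borel measure (regularity is automatic as K is metrizable). As K is
   closed in C, its Borel sets are the Borel subsets of C contained in K; only
   the values of mu on those matter. *)
Definition is_haar (K : set Ca) (mu : {measure set borel -> \bar R}) : Prop :=
  [/\ (0 < mu K)%E, (mu K < +oo)%E
    & forall (g : Ca) (A : set Ca), K g -> measurable (A : set borel) ->
        A `<=` K -> mu [set g + x | x in A] = mu A].

Definition valuation_integral_infinite (K : set Ca) : Prop :=
  exists2 mu : {measure set borel -> \bar R}, is_haar K mu &
    (\int[mu]_(x in K) valuation x = +oo)%E.

Definition cosets (K G : set Ca) : set (set Ca) :=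
  [set [set g + x | x in K] | g in G].

(* An infinite sequence of representatives, one for each coset of K in G. *)
Definition coset_representatives (K G : set Ca) (g : nat -> Ca) : Prop :=
  (forall n, G (g n)) /\ (forall x, G x -> exists! n, K (x - g n)).

End Valuation.

Section Subspaces.
Context {R : realType} {C : fieldType} {a : nonarch_absval R C}.
Local Notation Ca := (valued a).
Variables (F : finFieldType) (iota : {rmorphism F -> Ca}).

Definition is_subspace (G : set Ca) : Prop :=
  [/\ G 0, forall x y, G x -> G y -> G (x + y)
    & forall (c : F) x, G x -> G (iota c * x)].

Definition scriptG (r : R) : set (set Ca) :=
  [set G | [/\ is_subspace G,
     compact (G `&` Delta r),
     valuation_integral_infinite (G `&` Delta r)
   & finite_set (cosets (G `&` Delta r) G) \/
     ((cosets (G `&` Delta r) G #= [set: nat])%card /\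
      forall g, coset_representatives (G `&` Delta r) G g ->
        tends_to_infty g)]].

(* The family (lam n), n in J; values of lam outside J are irrelevant. *)
Definition free_family (J : set int) (lam : int -> Ca) : Prop :=
  forall (s : seq int) (c : int -> F), uniq s -> {in s, forall n, J n} ->
    \sum_(n <- s) iota (c n) * lam n = 0 -> {in s, forall n, c n = 0}.

Definition span_family (J : set int) (lam : int -> Ca) : set Ca :=
  [set x | exists (s : seq int) (c : int -> F),
     {in s, forall n, J n} /\ x = \sum_(n <- s) iota (c n) * lam n].

(* The index set J is an interval of int, possibly bounded on either side,
   possibly empty. Terms with n outside J are omitted from the sum. *)
Definition is_descending_basis (J : set int) (lam : int -> Ca) (G : set Ca)
  : Prop :=
  [/\ forall m n k, J m -> J k -> m <= n <= k -> J n,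
      free_family J lam /\ closure (span_family J lam) = G,
      forall m, J m -> lam m != 0 /\
        forall x, span_family [set n | J n /\ n <= m] lam x -> x != 0 ->
          absv (lam m) <= absv x,
      has_lbound J \/ tends_to_infty (fun n => lam (- n%:Z))
    & has_ubound J \/
      (\sum_(1 <= n < N | n%:Z \in J)
         valuation (lam n%:Z) * (#|F|%:R ^- n)%:E)%E
        @[N --> \oo] --> +oo%E].

Definition has_descending_basis (G : set Ca) : Prop :=
  exists J lam, is_descending_basis J lam G.

End Subspaces.

Definition is_discrete (T : topologicalType) (G : set T) : Prop :=
  G `<=` isolated G.

(* [locally_compact G] would ask for compact neighbourhoods in the ambient
   space rather than in G, hence the use of the subtype. *)
Definition is_locally_compact (T : topologicalType) (G : set T) : Prop :=
  locally_compact [set: set_type G].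

(* Main.v *)
(** A compact F_q-subspace K of C has a sequence l 0, l 1, ... of nonincreasing
    absolute value, each vector being farthest in K from the span of its
    predecessors and orthogonal to it. The balls of K have the mass dictated by
    this sequence, so the integral of the valuation over K is infinite if and only
    if the series of v(l n) q^-n is. A Haar measure on K is the image of the
    Lebesgue measure on [0, 1) under x |-> \sum_n d_n(x) l_n, with d_n(x) the
    base-q digits of x: on an open set it is the limit of the proportion of the
    q^N balls around partial sums which lie in the set, hence translation
    invariant. Condition (iii) amounts to compactness of all G cap Delta_t.
    Prolonging a basis of G cap Delta_r to the left by successive minima of G
    modulo G cap Delta_r gives a descending basis, and conversely the tails of a
    descending basis are such sequences for the balls of G; as descending bases do
    not mention r, neither does membership in the class. For a closed subspace H
    of G a pigeonhole argument gives |l_H n| <= |l_G n|, and the series for H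
    dominates that for G. *)
Require Import Defs.
From HB Require Import structures.
From mathcomp Require Import all_boot all_order all_algebra.
From mathcomp Require Import finfield.
From mathcomp Require Import all_classical all_reals all_analysis.
From mathcomp Require Import measurable_realfun lra.

Set Implicit Arguments.
Unset Strict Implicit.
Unset Printing Implicit Defensive.

Import Order.TTheory GRing.Theory Num.Theory.
Import numFieldNormedType.Exports.

Local Open Scope classical_set_scope.
Local Open Scope ring_scope.

(** Nonzero scalars are roots of unity, so they have absolute value 1, and the span of finitely many
    vectors is a finite set: nearest points in it exist and dimensions can be compared by counting.
    The Haar condition asserts that some measure exists, which gives the two implications different
    shapes. Upper bounds on the masses of spheres hold for any given Haar measure, by packing
    disjoint translates; a lower bound on the integral is sought for one explicit measure. The
    valuation has both signs. Integrals and series are compared through the positive part [v^\+]: on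
    a ball the negative part is bounded, while the mass and the total weight are finite. Condition
    (b) of a descending basis involves all indices to the left, possibly infinitely many. It becomes
    orthogonality to finitely many predecessors on the tail of vectors of absolute value at most t,
    because a nonzero combination of the earlier ones has absolute value greater than t. *)

(** * Ultrametric topology: balls, nets and compact sets *)

Section Ultrametric.
Context {R : realType} {C : fieldType} {a : nonarch_absval R C}.
Local Notation Ca := (valued a).
Implicit Types (x y z : Ca) (e : R) (A K G : set Ca).

Lemma absv_ge0 x : 0 <= absv x.
Proof. exact: absval_ge0. Qed.

Lemma absvM x y : absv (x * y) = absv x * absv y.
Proof. exact: absvalM. Qed.

Lemma absv_eq0 x : (absv x == 0) = (x == 0).
Proof. exact: absval_eq0. Qed.

Lemma absv_gt0 x : (0 < absv x) = (x != 0).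
Proof. by rewrite lt_neqAle absv_ge0 andbT eq_sym absv_eq0. Qed.

Lemma absvBC x y : absv (x - y) = absv (y - x).
Proof. by rewrite -absvN opprB. Qed.

Lemma absvD_le e x y : absv x <= e -> absv y <= e -> absv (x + y) <= e.
Proof.
by move=> xe ye; rewrite (le_trans (absvalD _ _ _))// ge_max; apply/andP; split.
Qed.

Lemma absvB_le e x y : absv x <= e -> absv y <= e -> absv (x - y) <= e.
Proof. by move=> xe ye; apply: absvD_le => //; rewrite absvN. Qed.

Lemma absvD_lt e x y : absv x < e -> absv y < e -> absv (x + y) < e.
Proof.
by move=> xe ye; rewrite (le_lt_trans (absvalD _ _ _))// gt_max; apply/andP; split.
Qed.

Lemma absv_trans_le e y x z :
  absv (x - y) <= e -> absv (y - z) <= e -> absv (x - z) <= e.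
Proof. by rewrite -(subrKA y x (- z)); exact: absvD_le. Qed.

Lemma absv_trans_lt e y x z :
  absv (x - y) < e -> absv (y - z) < e -> absv (x - z) < e.
Proof. by rewrite -(subrKA y x (- z)); exact: absvD_lt. Qed.

(** Otherwise [x = (x + y) - y] would be a difference of two elements smaller than [x]. *)
Lemma absv_dominant x y : absv y < absv x -> absv (x + y) = absv x.
Proof.
move=> yx; apply/eqP; rewrite eq_le; apply/andP; split.
  by apply: absvD_le => //; exact: ltW.
rewrite leNgt; apply/negP => xyx.
have := absvD_lt xyx (_ : absv (- y) < absv x).
by rewrite absvN addrK ltxx => /(_ yx).
Qed.

Lemma absv_sum_le (I : eqType) (s : seq I) (P : pred I) (f : I -> Ca) e :
  0 <= e -> (forall i, i \in s -> P i -> absv (f i) <= e) ->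
  absv (\sum_(i <- s | P i) f i) <= e.
Proof.
move=> e0 fe; rewrite big_seq_cond; elim/big_ind : _ => [|x y|i /andP[]].
- by rewrite absv0.
- exact: absvD_le.
- exact: fe.
Qed.

Lemma absv_lipschitz x y : `|absv x - absv y| <= absv (x - y).
Proof.
wlog xy : x y / absv y <= absv x.
  move=> h; case/orP: (le_total (absv y) (absv x)) => [/h//|/h].
  by rewrite distrC absvBC.
rewrite ger0_norm ?subr_ge0//.
case: (ltgtP (absv y) (absv x)) xy => // [{}xy _|-> _]; last first.
  by rewrite subrr absv_ge0.
by rewrite absv_dominant ?absvN// gerBl absv_ge0.
Qed.

Lemma nbhs_absvP x A :
  nbhs x A <-> exists2 e, 0 < e & forall y, absv (x - y) < e -> A y.
Proof.
split => [/nbhs_ballP[e /= e0 eA]|[e e0 eA]].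
  by exists e => // y xy; apply: eA; rewrite ballEmdist.
apply/nbhs_ballP; exists e => // y; rewrite ballEmdist; exact: eA.
Qed.

Lemma open_absvP A :
  open A <-> forall x, A x -> exists2 e, 0 < e & forall y, absv (x - y) < e -> A y.
Proof.
rewrite openE; split => h x Ax; first exact/nbhs_absvP/h.
exact/nbhs_absvP/h.
Qed.

Lemma closure_absvP A x :
  closure A x <-> forall e, 0 < e -> exists2 y, A y & absv (x - y) < e.
Proof.
split => [h e e0|h B /nbhs_absvP[e e0 eB]].
  have [|y [Ay xy]] := h [set y | absv (x - y) < e]; last by exists y.
  by apply/nbhs_absvP; exists e.
by have [y Ay xy] := h _ e0; exists y; split => //; exact: eB.
Qed.

Lemma lipschitz_continuous (d : Ca -> R) :
  (forall x y, `|d x - d y| <= absv (x - y)) -> continuous d.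
Proof.
move=> dL x B /nbhs_ballP[e /= e0 eB]; apply/nbhs_absvP; exists e => // y xy.
by apply: eB; exact: le_lt_trans (dL _ _) xy.
Qed.

Lemma continuous_absv : continuous (@absv R C a).
Proof. exact: lipschitz_continuous absv_lipschitz. Qed.

Lemma absv_lt_open x e : open [set y | absv (y - x) < e].
Proof.
apply/open_absvP => y /= yx; exists e => [|z yz].
  by apply: le_lt_trans yx; exact: absv_ge0.
by apply: absv_trans_lt yx; rewrite absvBC.
Qed.

Lemma absv_le_open x e : 0 < e -> open [set y | absv (y - x) <= e].
Proof.
move=> e0; apply/open_absvP => y /= yx; exists e => // z yz.
by apply: absv_trans_le yx; rewrite absvBC ltW.
Qed.

Lemma absv_ge_open x e : 0 < e -> open [set y | e <= absv (y - x)].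
Proof.
move=> e0; apply/open_absvP => y /= yx; exists e => // z yz.
have -> : z - x = (y - x) + (z - y) by rewrite [RHS]addrC subrKA.
by rewrite absv_dominant// absvBC (lt_le_trans yz).
Qed.

Lemma absv_le_closed x e : closed [set y | absv (y - x) <= e].
Proof.
move=> y /closure_absvP h; rewrite /= leNgt; apply/negP => ey.
have [|z ze yz] := h (absv (y - x) - e); first by rewrite subr_gt0.
have := absv_lipschitz (y - x) (z - x); rewrite leNgt => /negP; apply.
rewrite opprB addrA subrK (lt_le_trans yz)// (le_trans _ (ler_norm _))//.
by rewrite lerB.
Qed.

Lemma closed_Delta e : closed (@Delta R C a e).
Proof.
rewrite (_ : Delta e = [set y | absv (y - 0) <= e]); first exact: absv_le_closed.
by apply/seteqP; split => y; rewrite /= subr0.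
Qed.

Lemma hausdorff_valued : hausdorff_space Ca.
Proof. exact: metric_hausdorff. Qed.

Lemma compact_closed_valued K : compact K -> closed K.
Proof. by apply: compact_closed; exact: hausdorff_valued. Qed.

Lemma closed_point x : closed [set x].
Proof. exact/accessible_closed_set1/hausdorff_accessible/hausdorff_valued. Qed.

Lemma compact_net K e : compact K -> 0 < e ->
  exists s : seq Ca, (forall y, y \in s -> K y) /\
    forall x, K x -> exists2 y, y \in s & absv (x - y) < e.
Proof.
rewrite compact_cover => cK e0.
have [|x Kx|D DK Dc] := cK Ca K (fun x => [set y | absv (y - x) < e]).
- by move=> x _; exact: absv_lt_open.
- by exists x => //=; rewrite subrr absv0.
exists (finmap.enum_fset D); split => [y /DK/set_mem//|x Kx].
by have [y /= Dy xy] := Dc _ Kx; exists y.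
Qed.

(** An ultrafilter containing a finite union contains one of its members, so it contains a ball of
    each radius [e]; it is thus Cauchy, and completeness supplies the limit. *)
Lemma net_compact K : is_complete a -> closed K ->
  (forall e, 0 < e -> exists s : seq Ca,
    forall x, K x -> exists2 y, y \in s & absv (x - y) < e) -> compact K.
Proof.
move=> cpl clK netK; rewrite compact_ultra => Phi UPhi PhiK.
have ballPhi e : 0 < e -> exists y, Phi [set x | absv (y - x) < e].
  move=> e0; have [s Ks] := netK _ e0.
  have : Phi (\bigcup_(y in [set` s]) [set x | absv (x - y) < e]).
    by apply: filterS PhiK => x /Ks[y ys xy]; exists y.
  rewrite bigcup_seq; elim: s {Ks} => [|y s ih].
    rewrite big_nil => /filter_not_empty[].
  rewrite big_cons.
  have [yPhi _|] := in_ultra_setVsetC [set x | absv (x - y) < e] UPhi.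
    by exists y; apply: filterS yPhi => x /=; rewrite absvBC.
  move=> /filterI/[apply]; rewrite setIUr setICl set0U => h.
  by apply: ih; apply: filterS h => x [].
have : cauchy Phi.
  apply: cauchy_exP => e e0; have [y yPhi] := ballPhi _ e0.
  by exists y; apply: filterS yPhi => x; rewrite ballEmdist.
move=> /(cpl _ _)/cvg_ex[x Phix]; exists x; split => //.
by apply: clK => B /Phix PB; apply: (@filter_ex _ Phi); exact: filterI.
Qed.

(** Pigeonhole on a finite net of radius [e]. It later forces greedily chosen sequences to 0 or to
    infinity. *)
Lemma compact_not_separated K e (u : nat -> Ca) : compact K -> 0 < e ->
  (forall n, K (u n)) -> (forall m n, (m < n)%N -> e <= absv (u m - u n)) ->
  False.
Proof.
move=> cK e0 Ku ue; have [s [_ sK]] := compact_net cK e0.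
have /choice[f fP] : forall n, exists y, y \in s /\ absv (u n - y) < e.
  by move=> n; have [y] := sK _ (Ku n); exists y.
have injf : injective f.
  move=> m n; wlog mn : m n / (m < n)%N.
    by move=> h; case: (ltngtP m n) => // ? ?; [exact: h|exact/esym/h].
  move=> fmn; have := ue _ _ mn; rewrite leNgt => /negP; case.
  by apply: (absv_trans_lt (fP m).2); rewrite fmn absvBC; exact: (fP n).2.
have : (size [seq f n | n <- iota 0 (size s).+1] <= size s)%N.
  apply: uniq_leq_size; first by rewrite (map_inj_uniq injf) iota_uniq.
  by move=> _ /mapP[n _ ->]; case: (fP n).
by rewrite size_map size_iota ltnn.
Qed.

Lemma compact_bounded_Delta K : compact K -> exists2 t, 0 < t & K `<=` Delta t.
Proof.
move=> cK; have [s [_ sK]] := compact_net cK ltr01.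
exists (1 + \sum_(y <- s) absv y).
  by rewrite (lt_le_trans ltr01)// lerDl sumr_ge0// => *; exact: absv_ge0.
move=> x /sK[y ys xy]; rewrite /Delta/= -(subrK y x).
apply: absvD_le.
  by rewrite (le_trans (ltW xy))// lerDl sumr_ge0// => *; exact: absv_ge0.
rewrite (big_rem y)//= (le_trans _ (_ : absv y <= _))//.
by rewrite addrCA lerDl addr_ge0// sumr_ge0// => *; exact: absv_ge0.
Qed.

Lemma compact_translate K x : compact K -> compact [set x + y | y in K].
Proof.
move=> cK; apply: continuous_compact => //; apply: continuous_subspaceT => y.
move=> B /nbhs_absvP[e e0 eB]; apply/nbhs_absvP; exists e => // z yz.
by apply: eB; rewrite opprD addrACA subrr add0r.
Qed.

Lemma nearest_point (s : seq Ca) x y0 : y0 \in s ->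
  exists2 y, y \in s & forall z, z \in s -> absv (x - y) <= absv (x - z).
Proof.
elim: s y0 => // z s ih _ _; case: s ih => [_|w s ih].
  by exists z; [rewrite mem_head|move=> t; rewrite inE => /eqP->].
have [y ys yP] := ih w (mem_head _ _).
case: (leP (absv (x - y)) (absv (x - z))) => yz.
  exists y; first by rewrite inE ys orbT.
  by move=> t; rewrite inE => /orP[/eqP->|/yP].
exists z; first by rewrite mem_head.
by move=> t; rewrite inE => /orP[/eqP->//|/yP]; apply: le_trans; exact: ltW.
Qed.

End Ultrametric.

(** * Bases of compact subspaces *)

(** [P n l x] may refer to every earlier choice. The table [L n] records the first [n] choices; as
    [P n] sees only those, the diagonal sequence satisfies it. *)
Lemma dependent_choice_prefix (T : Type) (x0 : T)
    (P : nat -> (nat -> T) -> T -> Prop) :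
  (forall n l, exists x, P n l x) ->
  (forall n l l' x, (forall i, (i < n)%N -> l i = l' i) -> P n l x -> P n l' x) ->
  exists l, forall n, P n l (l n).
Proof.
move=> exP extP.
have /choice[f fP] : forall nl : nat * (nat -> T), exists x, P nl.1 nl.2 x.
  by move=> [n l]; exact: exP.
pose L := fix L n : nat -> T := if n is m.+1 then
  fun i => if i == m then f (m, L m) else L m i else fun=> x0.
have LE n i : (i < n)%N -> L n i = f (i, L i).
  elim: n => //= n ih; rewrite ltnS; case: eqP => [->//|ni im].
  by apply: ih; rewrite ltn_neqAle im andbT; apply/eqP.
exists (fun n => f (n, L n)) => n.
exact: (extP _ _ _ _ (fun i => @LE n i) (fP (n, L n))).
Qed.

Section Spaces.
Context {R : realType} {C : fieldType} {a : nonarch_absval R C}.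
Local Notation Ca := (valued a).
Context {F : finFieldType} (iota : {rmorphism F -> Ca}).
Implicit Types (x y z : Ca) (e : R) (A K G : set Ca) (l : nat -> Ca).
Implicit Types (c : nat -> F).

Lemma absv_iota (u : F) : u != 0 -> absv (iota u) = 1.
Proof.
move=> u0; have iu0 : iota u != 0 by rewrite fmorph_eq0.
apply/eqP; rewrite -(@pexpr_eq1 _ _ #|F|.-1) ?absv_ge0//; last first.
  by rewrite -ltnS prednK ?card_finNzRing_gt1// (ltn_trans _ (card_finNzRing_gt1 F)).
have absX n : absv (iota u) ^+ n = absv (iota u ^+ n).
  by elim: n => [|n ih]; rewrite ?expr0 ?absv1// !exprS ih absvM.
rewrite absX -rmorphXn.
have -> : u ^+ #|F|.-1 = 1.
  apply: (mulfI u0); rewrite -exprS prednK ?expf_card ?mulr1//.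
  by rewrite (ltn_trans _ (card_finNzRing_gt1 F)).
by rewrite rmorph1 absv1.
Qed.

Lemma absv_iotaM_le (u : F) x : absv (iota u * x) <= absv x.
Proof.
have [->|u0] := eqVneq u 0; first by rewrite rmorph0 mul0r absv0 absv_ge0.
by rewrite absvM absv_iota// mul1r.
Qed.

Lemma absv_iotaM (u : F) x : u != 0 -> absv (iota u * x) = absv x.
Proof. by move=> u0; rewrite absvM absv_iota// mul1r. Qed.

Lemma subspaceN G x : is_subspace iota G -> G x -> G (- x).
Proof. by case=> _ _ GZ Gx; rewrite -mulN1r -(rmorphN1 iota); exact: GZ. Qed.

Lemma subspaceB G x y : is_subspace iota G -> G x -> G y -> G (x - y).
Proof. by move=> sG Gx Gy; case: (sG) => _ + _; apply=> //; exact: subspaceN. Qed.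

Lemma subspace_sum G (I : eqType) (s : seq I) (P : pred I) (f : I -> Ca) :
  is_subspace iota G -> (forall i, i \in s -> P i -> G (f i)) ->
  G (\sum_(i <- s | P i) f i).
Proof.
move=> [G0 GD _] Gf; rewrite big_seq_cond.
by elim/big_ind : _ => // i /andP[]; exact: Gf.
Qed.

Lemma subspace_Delta e : 0 <= e -> is_subspace iota (Delta e).
Proof.
move=> e0; split=> [|x y|u x]; rewrite /Delta/= ?absv0//; first exact: absvD_le.
by move=> xe; rewrite (le_trans (absv_iotaM_le _ _)).
Qed.

Lemma subspaceI G K : is_subspace iota G -> is_subspace iota K ->
  is_subspace iota (G `&` K).
Proof.
move=> [G0 GD GZ] [K0 KD KZ]; split=> // [x y [? ?] [? ?]|u x [? ?]].
  by split; [exact: GD|exact: KD].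
by split; [exact: GZ|exact: KZ].
Qed.

Definition comb l n c : Ca := \sum_(i < n) iota (c i) * l i.

Definition initspan l n : set Ca := range (comb l n).

Lemma combS l n c : comb l n.+1 c = comb l n c + iota (c n) * l n.
Proof. by rewrite /comb big_ord_recr. Qed.

Lemma comb_ext l l' n c c' :
  (forall i, (i < n)%N -> l i = l' i) -> (forall i, (i < n)%N -> c i = c' i) ->
  comb l n c = comb l' n c'.
Proof. by move=> ll cc; apply: eq_bigr => i _; rewrite ll// cc. Qed.

Lemma initspan_ext l l' n : (forall i, (i < n)%N -> l i = l' i) ->
  initspan l n = initspan l' n.
Proof.
by move=> ll; apply: eq_imagel => c _; exact: comb_ext.
Qed.

Lemma subspace_initspan l n : is_subspace iota (initspan l n).
Proof.
split.
- by exists (fun=> 0) => //; rewrite /comb big1// => i _; rewrite rmorph0 mul0r.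
- move=> _ _ [c _ <-] [d _ <-]; exists (fun i => c i + d i) => //.
  by rewrite /comb -big_split; apply: eq_bigr => i _; rewrite rmorphD mulrDl.
- move=> u _ [c _ <-]; exists (fun i => u * c i) => //.
  by rewrite /comb mulr_sumr; apply: eq_bigr => i _; rewrite rmorphM mulrA.
Qed.

Lemma initspan_gen l n i : (i < n)%N -> initspan l n (l i).
Proof.
move=> ni; exists (fun j => (j == i)%:R) => //.
rewrite /comb (bigD1 (Ordinal ni))//= eqxx rmorph1 mul1r big1 ?addr0// => j ji.
by rewrite (_ : (_ == _) = false) ?rmorph0 ?mul0r//; exact: negbTE ji.
Qed.

Lemma initspan_le l m n : (m <= n)%N -> initspan l m `<=` initspan l n.
Proof.
move=> mn _ [c _ <-]; exists (fun i => if (i < m)%N then c i else 0) => //.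
rewrite /comb -(big_mkord xpredT (fun i => iota (c i) * l i)).
rewrite -(big_mkord xpredT (fun i => iota (if (i < m)%N then c i else 0) * l i)).
rewrite (big_cat_nat (n := m))//= [X in _ + X]big1_seq ?addr0; last first.
  move=> i /andP[_]; rewrite mem_index_iota => /andP[mi _].
  by rewrite ltnNge mi rmorph0 mul0r.
by rewrite !big_nat; apply: eq_bigr => i /andP[_ ->].
Qed.

Lemma initspan_sub l n G : is_subspace iota G ->
  (forall i, (i < n)%N -> G (l i)) -> initspan l n `<=` G.
Proof.
move=> sG Gl _ [c _ <-]; apply: subspace_sum => // i _ _.
by case: sG => _ _; apply; exact: Gl.
Qed.

Lemma initspan_seq l n :
  exists s : seq Ca, forall x, initspan l n x <-> x \in s.
Proof.
pose f (d : {ffun 'I_n -> F}) := \sum_(i < n) iota (d i) * l i.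
exists (codom f) => x; split => [[c _ <-]|/codomP[d ->]].
  apply/codomP; exists [ffun i : 'I_n => c i].
  by apply: eq_bigr => i _; rewrite ffunE.
exists (fun i => if insub i is Some j then d j else 0) => //.
by apply: eq_bigr => i _; rewrite valK.
Qed.

(* Condition (b) of a descending basis in the form "[l n] is orthogonal to the
   span of its predecessors". [l n] may be 0, which encodes termination on the
   right. *)
Definition reduced_basis K l : Prop :=
  [/\ forall n, K (l n),
      forall n v, initspan l n v -> absv (l n) <= absv (l n - v),
      forall n x, K x -> exists2 v, initspan l n v & absv (x - v) <= absv (l n)
    & forall e, 0 < e -> exists n, absv (l n) < e].

(** The vector [l n.+1] lies within [absv (l n)] of some [v] in the span of the first [n] vectors,
    and by orthogonality it is no longer than its distance to [v]. *)
Lemma reduced_basis_nonincr K l : reduced_basis K l ->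
  {homo (fun n => absv (l n)) : m n / (m <= n)%N >-> n <= m}.
Proof.
move=> [Kl lortho lnet _]; apply: homo_leq => [//|x y z yx zy|n].
  exact: le_trans zy yx.
have [v vs] := lnet n _ (Kl n.+1); apply: le_trans.
by apply: lortho; exact: initspan_le vs.
Qed.

(** The distance [d] to the finite subspace [s] is 1-Lipschitz, so it has a maximum on [K].
    Subtracting from a maximiser its nearest point in [s] gives a vector whose absolute value is
    that distance. *)
Lemma farthest_point K (s : seq Ca) : compact K -> is_subspace iota K ->
  is_subspace iota [set` s] -> {subset s <= K} ->
  exists2 x, K x & (forall v, v \in s -> absv x <= absv (x - v)) /\
    (forall y, K y -> exists2 v, v \in s & absv (y - v) <= absv x).
Proof.
move=> cK sK [s0 sD _] subK.
have /choice[p pP] : forall y, exists v, v \in s /\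
    forall z, z \in s -> absv (y - v) <= absv (y - z).
  by move=> y; have [v] := nearest_point y s0; exists v.
pose d y := absv (y - p y).
have dL x y : d x <= d y + absv (x - y).
  apply: (le_trans ((pP x).2 _ (pP y).1)).
  rewrite -[x - p y](subrKA y) (le_trans (absvalD _ _ _))// ge_max.
  by rewrite lerDl lerDr !absv_ge0.
have cd : continuous d.
  apply: lipschitz_continuous => x y.
  by rewrite ler_distl lerBlDr dL andbT absvBC dL.
have [||y /set_mem Ky yP] := @compact_EVT_max _ _ d K _ cK.
- by exists 0; case: sK.
- exact: continuous_subspaceT.
exists (y - p y); first by apply: subspaceB => //; exact/set_mem/subK/(pP y).1.
split=> [v vs|z Kz].
  by rewrite -addrA -opprD; apply: (pP y).2; apply: sD => //; exact: (pP y).1.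
by exists (p z); [exact: (pP z).1|exact/yP/mem_set].
Qed.

Lemma reduced_basis_exists K : compact K -> is_subspace iota K ->
  exists l, reduced_basis K l.
Proof.
move=> cK sK.
(* The premise on the prefix makes [P] satisfiable for every [l], as dependent choice requires; it
   is discharged afterwards by strong induction. *)
pose P n l x := (forall i, (i < n)%N -> K (l i)) ->
  [/\ K x, forall v, initspan l n v -> absv x <= absv (x - v) &
    forall y, K y -> exists2 v, initspan l n v & absv (y - v) <= absv x].
have [n l|n l l' x ll'|l lP] := @dependent_choice_prefix Ca 0 P.
- have [Kl|nKl] := pselect (forall i, (i < n)%N -> K (l i)); last by exists 0.
  have [s sP] := initspan_seq l n.
  have ss : [set` s] = initspan l n by apply/seteqP; split => x /sP.
  have [||x Kx [xs sx]] := farthest_point cK sK (s := s).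
  + by rewrite ss; exact: subspace_initspan.
  + by move=> v /sP vl; apply/mem_set; apply: initspan_sub vl.
  exists x => _; split => // [v /sP|y /sx[v vs yv]]; first exact: xs.
  by exists v => //; exact/sP.
- rewrite /P (initspan_ext ll') => h Kl'; apply: h => i ni.
  by rewrite ll'//; exact: Kl'.
have Kl n : K (l n).
  elim/ltn_ind : n => n ih; by have [] := lP n ih.
have lort n v : initspan l n v -> absv (l n) <= absv (l n - v).
  by have [_ + _] := lP n (fun i _ => Kl i); exact.
exists l; split => // [n x|e e0].
  by have [_ _] := lP n (fun i _ => Kl i); exact.
(* If no [absv (l n)] were below [e], the [l n] would be [e]-separated in [K], each being orthogonal
   to the earlier ones. *)
apply: contrapT => h.
apply: (compact_not_separated cK e0 Kl) => m n mn.
have en : e <= absv (l n) by rewrite leNgt; apply/negP => ne; apply: h; exists n.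
by rewrite (le_trans en)// absvBC; apply: lort; exact: initspan_gen.
Qed.

Lemma reduced_basis_compact K l : is_complete a -> closed K ->
  reduced_basis K l -> compact K.
Proof.
move=> cpl clK [_ _ lnet l0]; apply: net_compact => // e /l0[n lne].
have [s sP] := initspan_seq l n; exists s => x /(lnet n)[v /sP vs xv].
by exists v => //; exact: le_lt_trans lne.
Qed.

(** Induction on [n]. A last coefficient 0 is dropped, using monotonicity; otherwise it is factored
    out, leaving the last vector minus an element of the span of its predecessors. *)
Lemma reduced_basis_comb_ge K l n i c : reduced_basis K l ->
  (i < n.+1)%N -> c i != 0 -> absv (l n) <= absv (comb l n.+1 c).
Proof.
move=> Kl; case: (Kl) => _ lort _ _; elim: n => [|n ih] ni ci0.
  move: ni ci0; rewrite ltnS leqn0 => /eqP-> ci0.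
  by rewrite /comb big_ord1 absv_iotaM.
have [cn0|cn0] := eqVneq (c n.+1) 0.
  rewrite combS cn0 rmorph0 mul0r addr0.
  apply: le_trans (ih _ ci0); first exact: (reduced_basis_nonincr Kl).
  rewrite ltn_neqAle -ltnS ni andbT; apply: contraNneq ci0 => ->.
  by rewrite cn0.
have icn0 : iota (c n.+1) != 0 by rewrite fmorph_eq0.
have -> : comb l n.+2 c = iota (c n.+1) *
    (l n.+1 - iota (- (c n.+1)^-1) * comb l n.+1 c).
  rewrite combS rmorphN fmorphV mulrBr mulNr mulrN opprK mulrA divff// mul1r.
  by rewrite addrC.
rewrite absv_iotaM//; apply: lort.
by have [_ _] := subspace_initspan l n.+1; apply; exists c.
Qed.

(** If [absv (m n) < absv (l n)], each of the q^(n+1) combinations of the first n+1 vectors of [l]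
    is approximated within [absv (m n)] by one of the q^n combinations of the first n vectors of
    [m]. Two that share an approximation would differ by a nontrivial combination that is too short
    for [reduced_basis_comb_ge]. *)
Lemma reduced_basis_le K L l m : K `<=` L -> is_subspace iota L ->
  reduced_basis K l -> reduced_basis L m -> forall n, absv (l n) <= absv (m n).
Proof.
move=> KL sL Kl Lm n; rewrite leNgt; apply/negP => mn_ln.
case: (Kl) => Kln _ _ _; case: (Lm) => _ _ mnet _.
pose ext p (d : {ffun 'I_p -> F}) i := if insub i is Some j then d j else 0.
have extE p (d : {ffun 'I_p -> F}) (i : 'I_p) : ext p d i = d i.
  by rewrite /ext valK.
have /choice[f fP] : forall d : {ffun 'I_n.+1 -> F}, exists d' : {ffun 'I_n -> F},
    absv (comb l n.+1 (ext _ d) - comb m n (ext _ d')) <= absv (m n).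
  move=> d; have [|_ [c _ <-] cP] := mnet n (comb l n.+1 (ext _ d)).
    apply: (initspan_sub (l := l) (n := n.+1)) => // [i _|]; last by exists (ext _ d).
    exact: KL.
  exists [ffun i : 'I_n => c i]; rewrite (comb_ext (l := m) (l' := m) (c' := c))// => i ni.
  by rewrite (extE _ _ (Ordinal ni)) ffunE.
have injf : injective f.
  move=> d d' fdd'; apply/ffunP => i; apply/eqP; rewrite -subr_eq0.
  apply/negPn/negP => dd'i.
  have := reduced_basis_comb_ge (n := n) (i := i)
    (c := fun j => ext _ d j - ext _ d' j) Kl (ltn_ord i).
  rewrite !extE => /(_ dd'i); rewrite leNgt => /negP; apply.
  have -> : comb l n.+1 (fun j => ext _ d j - ext _ d' j) =
      comb l n.+1 (ext _ d) - comb l n.+1 (ext _ d').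
    by rewrite /comb -sumrB; apply: eq_bigr => j _; rewrite rmorphB mulrBl.
  apply: le_lt_trans mn_ln; apply: (absv_trans_le (fP d)).
  by rewrite absvBC fdd'; exact: fP.
have := leq_card f injf; rewrite !card_ffun !card_ord leq_exp2l ?ltnn//.
exact: card_finNzRing_gt1.
Qed.

End Spaces.

(** * Haar measure and the integral of the valuation *)

Section Borel.
Context {R : realType} {C : fieldType} {a : nonarch_absval R C}.
Local Notation Ca := (valued a).
Local Notation borel := (@borel R C a).
Local Notation v := (@valuation R C a).
Implicit Types (x y z : Ca) (e : R) (A K G : set Ca).

Lemma open_borel A : open A -> measurable (A : set borel).
Proof. exact: sub_sigma_algebra. Qed.

Lemma closed_borel A : closed A -> measurable (A : set borel).
Proof.
move=> /closed_openC oA; rewrite -[A]setCK.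
by apply: (@measurableC _ borel); exact: open_borel.
Qed.

Lemma lne_absv_itv e : 0 <= e -> e%:E \in `[0%E, +oo%E].
Proof. by move=> e0; rewrite in_itv/= leey lee_fin e0. Qed.

Lemma valuation_le x y : absv x <= absv y -> (valuation y <= valuation x)%E.
Proof.
by move=> xy; rewrite leeN2 lee_lne ?lee_fin// lne_absv_itv// absv_ge0.
Qed.

Lemma valuation0 : valuation (0 : Ca) = +oo%E.
Proof. by rewrite /valuation absv0 le0_lneNy. Qed.

Lemma valuationE x : x != 0 -> valuation x = (- ln (absv x))%:E.
Proof. by rewrite -absv_gt0 => x0; rewrite /valuation lne_EFin. Qed.

Lemma lt_valuation (y : R) z : (y%:E < valuation z)%E = (absv z < expR (- y)).
Proof.
rewrite /valuation lteNr -EFinN.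
have -> : (- y)%:E = lne (expR (- y))%:E by rewrite lne_EFin ?expR_gt0// expRK.
by rewrite lte_lne ?lte_fin// lne_absv_itv ?expR_ge0 ?absv_ge0.
Qed.

Lemma measurable_valuation :
  measurable_fun [set: borel] (valuation : borel -> \bar R).
Proof.
apply: (measurability _ (ErealGenOInfty.measurableE R)).
move=> _ [_ [y ->] <-]; rewrite setTI; apply: open_borel.
rewrite (_ : _ @^-1` _ = [set z : Ca | absv (z - 0) < expR (- y)]).
  exact: absv_lt_open.
by apply/seteqP; split => z /=; rewrite in_itv/= andbT lt_valuation subr0.
Qed.

Lemma measurable_valuation_pos D :
  measurable_fun D (valuation^\+%E : borel -> \bar R).
Proof.
apply: measurable_funTS; apply: measurable_funepos; exact: measurable_valuation.
Qed.

Lemma valuation_pos_le x y : absv x <= absv y ->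
  (valuation^\+ y <= valuation^\+ x)%E.
Proof.
by move=> /valuation_le xy; rewrite !funeposE ge_max !le_max xy lexx orbT.
Qed.

Lemma valuation_pos0 : (valuation^\+ (0%R : Ca) = +oo)%E.
Proof. by rewrite funeposE valuation0; exact: max_l. Qed.

Lemma valuation_pos_fin x : x != 0 -> (valuation^\+ x < +oo)%E.
Proof. by move=> x0; rewrite funeposE valuationE// gt_max !ltry. Qed.

(** On [Delta e] the negative part of the valuation is bounded, and [K] has finite mass, so its
    integral is finite. *)
Lemma integral_valuation_posP K (mu : {measure set borel -> \bar R}) e :
  measurable (K : set borel) -> (mu K < +oo)%E -> K `<=` Delta e ->
  (\int[mu]_(x in K) v x = +oo)%E <->
  (\int[mu]_(x in K) v^\+ x = +oo)%E.
Proof.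
move=> mK muK Ke; rewrite [in X in X <-> _]integralE.
have neg_fin : (\int[mu]_(x in K) (v^\- x) < +oo)%E.
  pose M := Num.max (ln e) 0.
  apply: (@le_lt_trans _ _ (\int[mu]_(x in K) cst M%:E x)%E); last first.
    rewrite integral_cst// lte_mul_pinfty// lee_fin le_max lexx orbT//.
  apply: ge0_le_integral => //.
  - apply: measurable_funTS; apply: measurable_funeneg.
    exact: measurable_valuation.
  - move=> x /Ke; rewrite /Delta/= => xe; rewrite funenegE.
    have [->|x0] := eqVneq x 0.
      by rewrite valuation0 /= max_r ?leNye// lee_fin le_max lexx orbT.
    rewrite valuationE// -EFinN opprK ge_max !lee_fin !le_max lexx orbT andbT.
    by rewrite ler_ln ?posrE ?xe// ?absv_gt0// (lt_le_trans _ xe)// absv_gt0.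
have neg_ge0 : (0 <= \int[mu]_(x in K) (v^\- x))%E.
  by apply: integral_ge0.
have neg_num : (\int[mu]_(x in K) (v^\- x))%E \is a fin_num.
  by rewrite ge0_fin_numE.
rewrite -(fineK neg_num).
by case: (\int[mu]_(x in K) _)%E => [r| |]; split.
Qed.

End Borel.

Section HaarSeries.
Context {R : realType} {C : fieldType} {a : nonarch_absval R C}.
Local Notation Ca := (valued a).
Local Notation borel := (@borel R C a).
Local Notation v := (@valuation R C a).
Context {F : finFieldType} (iota : {rmorphism F -> Ca}).
Local Notation q := (#|F|%:R : R).
Implicit Types (x y z : Ca) (e : R) (A K G : set Ca) (l : nat -> Ca).
Implicit Types (mu : {measure set borel -> \bar R}).

Lemma card_field_gt1 : 1 < q.
Proof. by rewrite ltr1n card_finNzRing_gt1. Qed.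

Lemma card_field_gt0 : 0 < q.
Proof. exact: lt_trans card_field_gt1. Qed.

Lemma image_translate x A : [set x + y | y in A] = (fun y => y - x) @^-1` A.
Proof.
apply/seteqP; split => [_ [y Ay <-]|y Ayx] /=; first by rewrite addrC addKr.
by exists (y - x) => //; rewrite addrC subrK.
Qed.

Lemma measurable_addr x : 
  measurable_fun (U := borel) [set: borel] (fun y : Ca => y + x).
Proof.
apply: (@measurability _ _ borel borel _ _ (@open Ca)) => // _ [U oU <-]; rewrite setTI.
apply: open_borel; apply/open_absvP => y /= Uy.
have [e e0 eU] := (@open_absvP R C a U).1 oU _ Uy; exists e => // z yz.
by apply: eU; rewrite opprD addrACA subrr addr0.
Qed.

Lemma measurable_translate x A :
  measurable (A : set borel) -> measurable ([set x + y | y in A] : set borel).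
Proof.
move=> mA; rewrite image_translate -[X in measurable X]setTI.
exact: (measurable_addr (- x)).
Qed.

Lemma haar_packing K mu A m (t : 'I_m -> Ca) :
  is_subspace iota K -> measurable (K : set borel) -> is_haar K mu ->
  measurable (A : set borel) -> A `<=` K -> (forall i, K (t i)) ->
  (forall i j x y, A x -> A y -> t i + x = t j + y -> i = j) ->
  (m%:R%:E * mu A <= mu K)%E.
Proof.
move=> [_ KD _] mK [_ _ invmu] mA AK Kt tinj.
pose T i : set borel := [set t i + x | x in A].
have mT i : measurable (T i) by exact: measurable_translate.
have -> : (m%:R%:E * mu A = mu (\big[setU/set0]_(i < m) T i))%E.
  rewrite measure_semi_additive_ord//.
  - rewrite (eq_bigr (fun=> mu A)); last by move=> i _; exact: invmu.
    by rewrite mule_natl sumr_const card_ord.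
  - by apply/trivIsetP => i j _ _ /eqP ij; apply/seteqP; split => // _ [[x Ax <-]
      [y Ay /esym/(tinj _ _ _ _ Ax Ay)]].
  - exact: bigsetU_measurable.
apply: le_measure; rewrite ?inE//; first exact: bigsetU_measurable.
rewrite -bigcup_seq => _ [i _ [x Ax <-]]; exact: KD (Kt _) (AK _ Ax).
Qed.

(** The q^n combinations of the first [n] basis vectors serve as translations; the last hypothesis
    makes the translates of [A] disjoint. *)
Lemma haar_packing_initspan K l mu A n :
  is_subspace iota K -> measurable (K : set borel) -> is_haar K mu ->
  reduced_basis iota K l -> measurable (A : set borel) -> A `<=` K ->
  (forall c i x y, (i < n)%N -> c i != 0 -> A x -> A y ->
    comb iota l n c != x - y) ->
  (mu A <= (q ^- n)%:E * mu K)%E.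
Proof.
move=> sK mK hmu [Kl _ _ _] mA AK sep.
pose ext (d : {ffun 'I_n -> F}) i := if insub i is Some j then d j else 0.
have extE (d : {ffun 'I_n -> F}) (i : 'I_n) : ext d i = d i by rewrite /ext valK.
have qn0 : 0 < q ^+ n by rewrite exprn_gt0// card_field_gt0.
pose t (i : 'I_#|{ffun 'I_n -> F}|) := comb iota l n (ext (enum_val i)).
have Kt i : K (t i).
  apply: (initspan_sub (iota := iota) (l := l) (n := n)) => //.
  by exists (ext (enum_val i)).
have tinj i j x y : A x -> A y -> t i + x = t j + y -> i = j.
  move=> Ax Ay eqxy; apply/eqP; rewrite -(inj_eq enum_val_inj) -subr_eq0.
  apply/eqP/ffunP => k; rewrite !ffunE; apply/eqP/negPn/negP => dk.
  have := sep (fun k => ext (enum_val i) k - ext (enum_val j) k) k y x (ltn_ord k).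
  rewrite !extE => /(_ dk Ay Ax) /eqP; apply.
  have -> : comb iota l n (fun k => ext (enum_val i) k - ext (enum_val j) k) =
      t i - t j.
    by rewrite /t /comb -sumrB; apply: eq_bigr => s _; rewrite rmorphB mulrBl.
  by apply/eqP; rewrite subr_eq addrAC eq_sym subr_eq addrC eqxy addrC.
have := haar_packing sK mK hmu mA AK Kt tinj.
rewrite card_ffun card_ord natrX => h.
by rewrite lee_pdivlMl.
Qed.

(** Take the least [n] with [absv (l n) <= absv x]. Were this strict, the approximation of [x] in
    the span of the first [n] vectors would have absolute value [absv x], less than that of
    [l n.-1], against [reduced_basis_comb_ge]. *)
Lemma reduced_basis_level K l x : reduced_basis iota K l -> K x -> x != 0 ->
  exists n, absv (l n) = absv x /\ forall m, (m < n)%N -> absv (l n) < absv (l m).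
Proof.
move=> Kl Kx x0; case: (Kl) => _ _ lnet l0.
have exn : exists n, absv (l n) <= absv x.
  by have [|n /ltW ?] := l0 (absv x); [rewrite absv_gt0|exists n].
case: (ex_minnP exn) => n nx nmin; exists n.
have lx m : (m < n)%N -> absv x < absv (l m).
  by move=> mn; rewrite ltNge; apply/negP => /nmin; rewrite leqNgt mn.
suff lnx : absv (l n) = absv x by split => // m /lx; rewrite lnx.
apply/eqP; rewrite eq_le nx leNgt; apply/negP => ln_x.
have [_ [c _ <-]] := lnet n _ Kx; case: n nx nmin lx ln_x => [|n] nx nmin lx ln_x.
  by rewrite /comb big_ord0 subr0 leNgt ln_x.
move=> xc; have absc : absv (comb iota l n.+1 c) = absv x.
  rewrite -[comb _ _ _ _](subKr x) absv_dominant// absvN.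
  exact: le_lt_trans ln_x.
have [c0|] := pselect (forall i, (i < n.+1)%N -> c i = 0).
  move/eqP: absc; rewrite /comb big1 => [|i _].
    by rewrite absv0 eq_sym absv_eq0 (negbTE x0).
  by rewrite c0 ?rmorph0 ?mul0r.
move=> /existsNP[i /not_implyP[ni /eqP ci]].
have := reduced_basis_comb_ge Kl ni ci.
by rewrite absc leNgt lx.
Qed.

(* [K] is split into the origin and the spheres [|x| = |l m|], each attached to
   the first [m] of its radius; translates of such a sphere by the span of the
   first [m] basis vectors are disjoint, so its mass is at most [q ^- m mu(K)]. *)
Lemma haar_integral_series K l mu : compact K -> is_subspace iota K ->
  reduced_basis iota K l -> is_haar K mu ->
  (\int[mu]_(x in K) v x = +oo ->
  \sum_(n <oo) v^\+ (l n) * (q ^- n)%:E = +oo)%E.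
Proof.
move=> cK sK Kl hmu intoo; case: (hmu) => muK0 muKoo _.
have mK : measurable (K : set borel).
  by apply: closed_borel; exact: compact_closed_valued.
have qn0 n : 0 < q ^- n by rewrite invr_gt0 exprn_gt0// card_field_gt0.
have term_ge0 n : (0 <= v^\+ (l n) * (q ^- n)%:E)%E.
  by rewrite mule_ge0// lee_fin ltW.
have [[n ln0]|/forallNP lN0] := pselect (exists n, l n = 0).
  apply: (nneseries_pinfty (k := n)) => //.
  by rewrite ln0 valuation_pos0 mulyr gtr0_sg ?mul1e.
have {}lN0 n : l n != 0 by apply/eqP.
apply/eqP; rewrite -leye_eq leNgt; apply/negP => serfin.
have [t _ Kt] := compact_bounded_Delta cK.
move: intoo => /(integral_valuation_posP mK muKoo Kt).1.
pose B n : set Ca := if n is m.+1 then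
  [set x | [/\ K x, absv x = absv (l m) &
    forall i, (i < m)%N -> absv (l m) < absv (l i)]] else [set 0].
have mB n : measurable (B n : set borel).
  case: n => [|n] /=.
    by apply: closed_borel; exact: closed_point.
  have [first|nfirst] := pselect (forall i, (i < n)%N -> absv (l n) < absv (l i)).
    rewrite (_ : [set x | _] = K `&` ([set x | absv (x - 0) <= absv (l n)] `&`
        [set x | absv (l n) <= absv (x - 0)])).
      apply: measurableI => //; apply: measurableI; apply: open_borel.
        by apply: absv_le_open; rewrite absv_gt0.
      by apply: absv_ge_open; rewrite absv_gt0.
    apply/seteqP; split => x /=; rewrite subr0.
      by move=> [Kx -> _].
    by move=> [Kx [xl lx]]; split => //; apply/eqP; rewrite eq_le xl.
  by rewrite (_ : [set x | _] = set0)// -subset0 => x [].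
have KE : K = \bigcup_n B n.
  apply/seteqP; split => [x Kx|x [[|n] _] /=]; last 2 first.
  - by move=> ->; case: sK.
  - by case.
  have [->|x0] := eqVneq x 0; first by exists 0%N.
  by have [n [lx lm]] := reduced_basis_level Kl Kx x0; exists n.+1.
have tB : trivIset setT B.
  apply/trivIsetP => i j _ _; wlog ij : i j / (i < j)%N.
    move=> h; rewrite neq_ltn => /orP[] ij; first by rewrite h// ltn_eqF.
    by rewrite setIC h// ltn_eqF.
  move=> _; rewrite -subset0; case: j ij => // j; case: i => [_|i].
    move=> x [/= -> [_ + _]]; rewrite absv0 => /esym/eqP.
    by rewrite absv_eq0 (negbTE (lN0 _)).
  rewrite ltnS => ij x [[_ xi _] [_ xj /(_ _ ij)]].
  by rewrite -xi -xj ltxx.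
(* Translates of the origin by the combinations of the first [n] vectors are distinct points, so its
   mass is at most q^-n times that of [K], for every [n]. *)
have mu0 : mu (B 0%N) = 0%E.
  apply/eqP; rewrite eq_le measure_ge0 andbT; apply/lee_addgt0Pr => e e0.
  rewrite add0e.
  have [n qne] : exists n, (q ^- n * fine (mu K) <= e).
    have muKr0 : 0 <= fine (mu K) / e by rewrite divr_ge0// ?fine_ge0// ltW.
    (* This integer exceeds [fine (mu K) / e], and [n < q ^+ n]. *)
    exists (Num.trunc (fine (mu K) / e)).+1; set n := (_.+1).
    rewrite mulrC ler_pdivrMr ?exprn_gt0 ?card_field_gt0// -ler_pdivrMl//.
    rewrite [e^-1 * _]mulrC.
    have /andP[_ /ltW/le_trans] := truncn_itv muKr0; apply.
    by rewrite -natrX ler_nat ltnW// ltn_expl// card_finNzRing_gt1.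
  apply: (le_trans _ (_ : (q ^- n * fine (mu K))%:E <= _)%E); last by rewrite lee_fin.
  rewrite EFinM fineK ?ge0_fin_numE//.
  apply: (haar_packing_initspan sK mK hmu Kl) => //=.
  - exact: (mB 0%N).
  - by move=> _ ->; case: sK.
  - move=> c i x y; case: n {qne} => // n ni ci -> ->; rewrite subrr -absv_gt0.
    by rewrite (lt_le_trans _ (reduced_basis_comb_ge Kl ni ci))// absv_gt0.
(* For [n > 0], two points of the sphere differ by at most [absv (l n)], which is less than
   [absv (l n.-1)], whereas a nontrivial combination of the first [n] vectors is at least as long as
   [l n.-1]. *)
have muB n : (mu (B n.+1) <= (q ^- n)%:E * mu K)%E.
  apply: (haar_packing_initspan sK mK hmu Kl) => // [x [//]|c i x y ni ci].
  case=> [Kx xl first] [Ky yl _]; apply/eqP => cxy.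
  case: n ni xl first yl cxy => // n ni xl first yl cxy.
  have := reduced_basis_comb_ge Kl ni ci; rewrite cxy leNgt => /negP; apply.
  apply: le_lt_trans (first n (ltnSn _)).
  by apply: absvB_le; rewrite ?xl ?yl.
have -> : (\int[mu]_(x in K) v^\+ x =
    \sum_(n <oo) \int[mu]_(x in B n) v^\+ x)%E.
  by rewrite [in LHS]KE ge0_integral_bigcup//; exact: measurable_valuation_pos.
apply/eqP; rewrite lt_eqF//.
apply: (@le_lt_trans _ _ (\sum_(n <oo) (mu K * (v^\+ (l n) * (q ^- n)%:E)))%E).
  rewrite nneseries_recl//; last by move=> n _; exact: integral_ge0.
  rewrite null_set_integral ?add0e//; last exact: measurable_valuation_pos.
  rewrite -[in leLHS](nneseries_addn 1); last by move=> n; exact: integral_ge0.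
  apply: lee_nneseries => [n _ _|n _]; first exact: integral_ge0.
  rewrite addn1.
  apply: (@le_trans _ _ (\int[mu]_(x in B n.+1) cst (v^\+ (l n)) x)%E).
    apply: ge0_le_integral => //; first exact: measurable_valuation_pos.
    by move=> x [_ xl _]; apply: valuation_pos_le; rewrite xl.
  rewrite integral_cst// muleC (le_trans (lee_wpmul2r _ (muB n)))//.
  by rewrite -muleA [leLHS]muleC muleA.
have muKfin : mu K \is a fin_num by rewrite ge0_fin_numE.
rewrite -(fineK muKfin) nneseriesZl//.
by rewrite lte_mul_pinfty// lee_fin fine_ge0.
Qed.

End HaarSeries.

(** * Construction of a Haar measure *)

Section Digits.
Context {R : realType} {C : fieldType} {a : nonarch_absval R C}.
Local Notation Ca := (valued a).
Context {F : finFieldType} (iota : {rmorphism F -> Ca}).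
Local Notation q := (#|F|%:R : R).
Implicit Types (x : R) (K : set Ca) (l : nat -> Ca) (c : nat -> F).

(* 0 comes first, so that the leading digits of a small number are 0. *)
Definition digit (d : nat) : F := nth 0 (0 :: [seq u <- enum F | u != 0]) d.

Lemma sum_digit (V : nmodType) (f : F -> V) :
  \sum_(0 <= d < #|F|) f (digit d) = \sum_(u : F) f u.
Proof.
pose s : seq F := 0 :: [seq u <- enum F | u != 0].
have sF : perm_eq s (enum F).
  apply: uniq_perm; [|exact: enum_uniq|move=> u].
    by rewrite /s cons_uniq filter_uniq ?enum_uniq// mem_filter eqxx.
  by rewrite inE mem_filter mem_enum andbT; case: eqP.
have <- : size s = #|F| by rewrite (perm_size sF) cardE.
by rewrite -(big_nth 0 xpredT f) (perm_big _ sF) big_enum.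
Qed.

(** The leading one of the [N] base-q digits of [k] goes with [l 0], the last with [l N.-1].
    Dividing [k] by q thus removes the last vector, so successive truncations of an expansion extend
    one another. *)
Fixpoint digit_sum l N (k : nat) : Ca := if N is M.+1 then
  digit_sum l M (k %/ #|F|) + iota (digit (k %% #|F|)) * l M else 0.

Lemma digit_sum0 l N : digit_sum l N 0 = 0.
Proof. by elim: N => //= N ih; rewrite div0n mod0n ih rmorph0 mul0r addr0. Qed.

Lemma sum_digit_sumS (V : nmodType) l N (f : Ca -> V) :
  \sum_(0 <= k < #|F| ^ N.+1) f (digit_sum l N.+1 k) =
  \sum_(0 <= k < #|F| ^ N) \sum_(u : F) f (digit_sum l N k + iota u * l N).
Proof.
have F0 : (0 < #|F|)%N := ltnW (card_finNzRing_gt1 F).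
rewrite expnSr big_nat_mul; apply: eq_bigr => k _.
rewrite -(sum_digit (fun u => f (digit_sum l N k + iota u * l N))).
rewrite -{1}[(k * #|F|)%N]add0n big_addn mulSn addnK [LHS]big_nat [RHS]big_nat.
apply: eq_bigr => d /andP[_ dF] /=.
by rewrite addnC divnMDl// divn_small// addn0 modnMDl modn_small.
Qed.

(** Adding a combination of basis vectors shifts each digit by a constant of [F], without carries,
    and so permutes the digit sums. Translation invariance of the measure rests on this. *)
Lemma sum_digit_sum_translate (V : nmodType) l N c (f : Ca -> V) :
  \sum_(0 <= k < #|F| ^ N) f (digit_sum l N k) =
  \sum_(0 <= k < #|F| ^ N) f (digit_sum l N k + comb iota l N c).
Proof.
elim: N f => [|N ih] f; first by rewrite /comb big_ord0 !big_nat1 addr0.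
rewrite sum_digit_sumS (ih (fun y => \sum_(u : F) f (y + iota u * l N))).
rewrite (sum_digit_sumS l N (fun y => f (y + comb iota l N.+1 c))).
apply: eq_bigr => k _; rewrite (reindex_inj (addIr (c N))) /=.
apply: eq_bigr => u _; congr f.
by rewrite combS rmorphD mulrDl -!addrA; congr +%R; rewrite addrCA.
Qed.

Lemma truncn_divn x N :
  (Num.trunc (q ^+ N.+1 * x) %/ #|F|)%N = Num.trunc (q ^+ N * x).
Proof.
have F0 : (0 < #|F|)%N := ltnW (card_finNzRing_gt1 F).
have [x0|x0] := ltP x 0.
  have neg n : Num.trunc (q ^+ n * x) = 0%N.
    apply/truncn0Pn; rewrite -ltNge (lt_trans _ ltr01)// nmulr_llt0//.
    by rewrite exprn_gt0// ltr0n.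
  by rewrite !neg div0n.
set y := q ^+ N * x.
have y0 : 0 <= y by rewrite mulr_ge0// exprn_ge0.
rewrite exprS -mulrA -/y; have /andP[ny yn] := truncn_itv y0.
have qy0 : 0 <= q * y by rewrite mulr_ge0.
have /andP[mqy qym] := truncn_itv qy0.
apply/eqP; rewrite eqn_leq -ltnS ltn_divLR// leq_divRL//.
rewrite ![(_ * #|F|)%N]mulnC -(ltr_nat R) natrM (le_lt_trans mqy)/=; last first.
  by rewrite ltr_pM2l// ltr0n.
by rewrite -ltnS -(ltr_nat R) (le_lt_trans _ qym)// natrM ler_pM2l// ltr0n.
Qed.

Definition expansion l N x : Ca := digit_sum l N (Num.trunc (q ^+ N * x)).

(** Each further digit adds a scalar multiple of a vector no longer than [l N], and in the
    ultrametric inequality errors do not add up. *)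
Lemma expansion_cauchy K l x N M : reduced_basis iota K l -> (N <= M)%N ->
  absv (expansion l M x - expansion l N x) <= absv (l N).
Proof.
move=> Kl; elim: M => [|M ih] NM.
  by move: NM; rewrite leqn0 => /eqP->; rewrite subrr absv0 absv_ge0.
have [->|NM'] := eqVneq N M.+1; first by rewrite subrr absv0 absv_ge0.
have {NM'}NM : (N <= M)%N by rewrite -ltnS ltn_neqAle NM' NM.
apply: absv_trans_le (ih NM).
rewrite /expansion/= truncn_divn addrC addKr.
rewrite (le_trans (absv_iotaM_le _ _ _))//; exact: (reduced_basis_nonincr Kl).
Qed.

Lemma expansion_limit K l : compact K -> is_subspace iota K ->
  reduced_basis iota K l -> exists phi : R -> Ca, forall x,
    K (phi x) /\ forall N, absv (phi x - expansion l N x) <= absv (l N).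
Proof.
move=> cK sK Kl; suff /choice[phi phiP] : forall x, exists y,
    K y /\ forall N, absv (y - expansion l N x) <= absv (l N) by exists phi.
move=> x.
have Ku N : K (expansion l N x).
  rewrite /expansion; move: (Num.trunc _) => k.
  have [K0 KD KZ] := sK; have [Kln _ _ _] := Kl.
  by elim: N k => //= N ih k; apply: KD => //; exact: KZ.
(* Compactness gives a cluster point of the truncations; by [expansion_cauchy] it is within
   [absv (l N)] of the truncation to [N] digits. *)
have [|y [Ky yu]] := cK (expansion l n x @[n --> \oo]) _.
  by exists 0%N => // n _; exact: Ku.
exists y; split => // N; rewrite leNgt; apply/negP => lN.
have [||_ [[M /= NM <-]]] := yu (range (fun M => expansion l (N + M) x))
  [set z | absv (y - z) < absv (y - expansion l N x)].
- by exists N => // M /= NM; exists (M - N)%N; rewrite ?subnKC.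
- apply/nbhs_absvP; exists (absv (y - expansion l N x)) => //.
  exact: le_lt_trans (absv_ge0 _) lN.
move=> yM; suff : absv (y - expansion l N x) < absv (y - expansion l N x).
  by rewrite ltxx.
apply: absv_trans_lt yM _; apply: le_lt_trans lN.
by apply: expansion_cauchy Kl _; exact: leq_addr.
Qed.

End Digits.

Section HaarConstruction.
Context {R : realType} {C : fieldType} {a : nonarch_absval R C}.
Local Notation Ca := (valued a).
Local Notation borel := (@borel R C a).
Local Notation v := (@valuation R C a).
Context {F : finFieldType} (iota : {rmorphism F -> Ca}).
Local Notation q := (#|F|%:R : R).
Implicit Types (x : R) (K U : set Ca) (l : nat -> Ca).

Let mI : measurable (`[0, 1[%classic : set (measurableTypeR R)).
Proof. exact: measurable_itv. Qed.

Let unif : {measure set (measurableTypeR R) -> \bar R} :=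
  mrestr (@lebesgue_measure R) mI.

Let qn_gt0 n : 0 < q ^+ n.
Proof. by rewrite exprn_gt0// card_field_gt0. Qed.

Lemma measurable_trunc N (P : set nat) :
  measurable ([set x | P (Num.trunc (q ^+ N * x))] : set (measurableTypeR R)).
Proof.
rewrite (_ : [set x | _] =
  \bigcup_(k in P) [set x : R | Num.trunc (q ^+ N * x) = k]); last first.
  by apply/seteqP; split => [x Px|x [k Pk /= ->//]]; exists (Num.trunc (q ^+ N * x)).
(* [Num.trunc] is also 0 on negative numbers, so the level set of 0 is a half-line. *)
apply: bigcup_measurable => -[|k] _.
  rewrite (_ : [set x | _] = `]-oo, (q ^- N)[%classic); first exact: measurable_itv.
  apply/seteqP; split => x /=; rewrite in_itv/=.
    by move=> /truncn0Pn; rewrite -ltNge -ltr_pdivlMl// mulr1.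
  by move=> xN; apply/truncn0Pn; rewrite -ltNge -ltr_pdivlMl// mulr1.
rewrite (_ : [set x | _] = `[(q ^- N * k.+1%:R), (q ^- N * k.+2%:R)[%classic).
  exact: measurable_itv.
apply/seteqP; split => x /=; rewrite in_itv/= ler_pdivrMl// ltr_pdivlMl//.
  move=> Nk; have x0 : 0 <= q ^+ N * x.
    rewrite leNgt; apply/negP => x0; suff : Num.trunc (q ^+ N * x) = 0%N.
      by rewrite Nk.
    by apply/truncn0Pn; rewrite -ltNge (lt_trans x0).
  by rewrite -truncn_eq// Nk.
move=> kx; apply/eqP; rewrite truncn_eq//.
by case/andP: kx => kx _; rewrite (le_trans _ kx).
Qed.

Lemma unif_trunc N (P : set nat) :
  unif [set x | P (Num.trunc (q ^+ N * x))] =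
  (q ^- N * \sum_(0 <= k < #|F| ^ N) (`[< P k >])%:R)%:E.
Proof.
pose D k : set (measurableTypeR R) := if `[< P k >] then
  `[(q ^- N * k%:R), (q ^- N * k.+1%:R)[%classic else set0.
have DE k x : 0 <= x -> D k x <-> P k /\ Num.trunc (q ^+ N * x) = k.
  move=> x0; have qx0 : 0 <= q ^+ N * x by rewrite mulr_ge0// ltW.
  rewrite /D; case: asboolP => Pk; last by split => // -[].
  rewrite /= in_itv/= ler_pdivrMl// ltr_pdivlMl// -truncn_eq//.
  by split => [/eqP|[_ /eqP]].
have D0 k x : D k x -> 0 <= x.
  rewrite /D; case: ifP => //= _; rewrite in_itv/= => /andP[kx _].
  by rewrite (le_trans _ kx)// mulr_ge0// invr_ge0 ltW.
have mD k : measurable (D k) by rewrite /D; case: ifP => // _; exact: measurable_itv.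
have -> : unif [set x | P (Num.trunc (q ^+ N * x))] =
    lebesgue_measure (\big[setU/set0]_(k < #|F| ^ N) D k).
  rewrite /unif /= /mrestr; congr lebesgue_measure.
  rewrite -(bigcup_mkord _ D); apply/seteqP; split => x /=.
    rewrite in_itv/= => -[Px /andP[x0 x1]].
    have qx0 : 0 <= q ^+ N * x by rewrite mulr_ge0// ltW.
    exists (Num.trunc (q ^+ N * x)); last exact/DE.
    by rewrite /= truncn_lt_nat// natrX gtr_pMr.
  move=> [k /= kN Dkx]; have x0 := D0 _ _ Dkx.
  have /(DE _ _ x0)[Pk kx] := Dkx; split; first by rewrite kx.
  have qx0 : 0 <= q ^+ N * x by rewrite mulr_ge0// ltW.
  by rewrite in_itv/= x0/=; move: kN; rewrite -kx truncn_lt_nat// natrX gtr_pMr.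
rewrite measure_semi_additive_ord_I//; last 2 first.
- apply/trivIsetP => i j _ _ ij; rewrite -subset0 => x [Di Dj].
  have x0 := D0 _ _ Di; have [_ xi] := (DE _ _ x0).1 Di.
  by have [_ xj] := (DE _ _ x0).1 Dj; move/eqP: ij; apply; rewrite -xi.
- exact: bigsetU_measurable.
rewrite big_mkord mulr_sumr -sumEFin; apply: eq_bigr => k _.
rewrite /D; case: asboolP => Pk; last by rewrite measure0 mulr0.
apply: (etrans (lebesgue_measure_itv _)); rewrite /= lte_fin ltr_pM2l ?invr_gt0// ltr_nat ltnSn.
by rewrite -EFinD -mulrBr -natrB// subSn// subnn.
Qed.

Section Limit.
Variables (K : set Ca) (l : nat -> Ca) (phi : R -> Ca).
Hypothesis cK : compact K.
Hypothesis Kl : reduced_basis iota K l.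
Hypothesis phiK : forall x, K (phi x).
Hypothesis phiE : forall x N, absv (phi x - expansion iota l N x) <= absv (l N).

(** The radius is the error of a truncation to [N] digits: a truncation in [inball N U] forces
    [phi x] into [U], whatever digits follow. *)
Let inball N U : set Ca := [set y | forall z, absv (z - y) <= absv (l N) -> U z].

Lemma preimage_expansion_limit U : open U ->
  phi @^-1` U = \bigcup_N [set x | inball N U (expansion iota l N x)].
Proof.
move=> /open_absvP oU; apply/seteqP; split => [x Ux|x [N _ /= NU]]; last exact: NU.
have [e e0 eU] := oU _ Ux; have [_ _ _ /(_ _ e0)[N lNe]] := Kl.
exists N => // z zx; apply: eU; apply: le_lt_trans lNe.
by apply: absv_trans_le (phiE x N) _; rewrite absvBC.
Qed.

Lemma measurable_expansion_limit :
  measurable_fun (U := borel) [set: measurableTypeR R] phi.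
Proof.
apply: (@measurability _ _ _ borel _ _ (@open Ca)) => // _ [U oU <-].
rewrite setTI preimage_expansion_limit//; apply: bigcupT_measurable => N.
exact: (measurable_trunc N [set k | inball N U (digit_sum iota l N k)]).
Qed.

(* The law of [\sum_n d_n l_n], where [d_n] are the base-[q] digits of a uniform
   random number in [0, 1), read as elements of [F]. *)
Definition expansion_measure : {measure set borel -> \bar R} :=
  measure_function_pushforward__canonical__measure_function_Measure
    unif measurable_expansion_limit.

Let approx N U :=
  q ^- N * \sum_(0 <= k < #|F| ^ N) (`[< inball N U (digit_sum iota l N k) >])%:R.

(** Membership of [phi x] in an open [U] shows after finitely many digits and persists, so the
    events [T N] increase to the preimage of [U]; their masses are the [approx N U]. *)
Lemma expansion_measure_open U : open U ->
  (approx N U)%:E @[N --> \oo] --> expansion_measure U.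
Proof.
move=> oU; rewrite /expansion_measure/= /pushforward preimage_expansion_limit//.
pose T N := [set x | inball N U (expansion iota l N x)] : set (measurableTypeR R).
have mT N : measurable (T N).
  exact: (measurable_trunc N [set k | inball N U (digit_sum iota l N k)]).
rewrite (_ : (fun N => _) = unif \o T).
  apply: nondecreasing_cvg_mu => //; first exact: bigcupT_measurable.
  move=> N M NM; apply/subsetPset => x /= NU z zM; apply: NU.
  apply: absv_trans_le (expansion_cauchy _ Kl NM).
  by rewrite (le_trans zM)//; exact: (reduced_basis_nonincr Kl).
by apply/funext => N; rewrite /= /approx -unif_trunc.
Qed.

(** At scale [absv (l N)], translation by [g] is indistinguishable from translation by an
    approximating combination of the first [N] vectors, which permutes the digit sums. *)
Lemma approx_translate N g U : K g -> approx N [set g + y | y in U] = approx N U.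
Proof.
move=> Kg; have [_ _ + _] := Kl => /(_ N g Kg)[_ [c _ <-] gc].
rewrite /approx; congr *%R; rewrite image_translate.
rewrite (sum_digit_sum_translate iota l N c
  (fun y => (`[< inball N ((fun y => y - g) @^-1` U) y >])%:R)).
apply: eq_bigr => k _; congr (nat_of_bool _)%:R; apply: asbool_equiv_eq.
split => inU z zk.
  rewrite -(addrK g z); apply: (inU (z + g)).
  by rewrite opprD addrACA; exact: absvD_le.
apply: inU; move: (absvB_le zk gc).
by rewrite opprD opprB !addrA subrK [z - _ - _]addrAC.
Qed.

Lemma expansion_measure_translate g U : K g -> open U ->
  expansion_measure [set g + y | y in U] = expansion_measure U.
Proof.
move=> Kg oU; apply/esym/(cvg_unique _ (expansion_measure_open oU)) => //.
have ogU : open [set g + y | y in U].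
  rewrite image_translate; apply/open_absvP => y /= Uyg.
  have [e e0 eU] := (open_absvP U).1 oU _ Uyg.
  by exists e => // z yz; apply: eU; rewrite opprD opprK addrACA addNr addr0.
rewrite (_ : (fun N => _) = (fun N => (approx N [set g + y | y in U])%:E)).
  exact: expansion_measure_open.
by apply/funext => N; rewrite approx_translate.
Qed.

Lemma expansion_measure_haar : is_haar K expansion_measure.
Proof.
have mu1 A : (forall x, A (phi x)) -> expansion_measure A = 1%E.
  move=> Aphi; rewrite /expansion_measure /= /pushforward.
  rewrite (_ : phi @^-1` A = setT); last by apply/seteqP; split => // x _; exact: Aphi.
  rewrite /unif /= /mrestr setTI; apply: (etrans (lebesgue_measure_itv _)).
  by rewrite /= lte_fin ltr01 sube0.
split; [by rewrite mu1|by rewrite mu1// ltry|].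
move=> g A Kg mA _; rewrite image_translate.
(* [mu'] gives a set the mass of its translate by [g]. Both measures are finite and agree on open
   sets, which are stable under intersection and generate the Borel sets. *)
pose mu' : {measure set borel -> \bar R} :=
  measure_function_pushforward__canonical__measure_function_Measure
    expansion_measure (measurable_addr (- g)).
apply/esym; apply: (@measure_unique _ _ borel (@open Ca) (fun=> setT) _ _ _ _
  expansion_measure mu') => //.
- by move=> ? ? ? ?; exact: openI.
- by move=> _; exact: openT.
- by apply/seteqP; split => // x _; exists 0%N.
- move=> U oU; rewrite -(expansion_measure_translate Kg oU) image_translate.
  by rewrite /mu'.
- by move=> _; rewrite mu1// ltry.
Qed.

(* If [q ^- n.+1 <= x < q ^- n] then the first [n] digits of [x] vanish, hence
   [|phi x| <= |l n|]. *)
Lemma expansion_measure_integral :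
  (\sum_(n <oo) v^\+ (l n) * (q ^- n)%:E = +oo ->
  \int[expansion_measure]_(x in K) v^\+ x = +oo)%E.
Proof.
move=> ser; have mK : measurable (K : set borel).
  by apply: closed_borel; exact: compact_closed_valued.
rewrite ge0_integral_pushforward//; last 2 first.
- exact: measurable_expansion_limit.
- exact: measurable_valuation_pos.
rewrite (_ : phi @^-1` K = setT); last by apply/seteqP; split => // x _; exact: phiK.
pose D n : set (measurableTypeR R) := `[q ^- n.+1, q ^- n[%classic.
have mD n : measurable (D n) by exact: measurable_itv.
have qV_le m n : (m <= n)%N -> q ^- n <= q ^- m.
  by move=> mn; rewrite lef_pV2 ?posrE ?qn_gt0// ler_weXn2l// ltW// card_field_gt1.
have tD : trivIset setT D.
  apply/trivIsetP => i j _ _; wlog ij : i j / (i < j)%N.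
    move=> h; rewrite neq_ltn => /orP[] ij; first by rewrite h// ltn_eqF.
    by rewrite setIC h// ltn_eqF.
  move=> _; rewrite -subset0 => x []; rewrite /D/= !in_itv/=.
  move=> /andP[xi _] /andP[_ xj].
  by have := lt_le_trans xj (le_trans (qV_le _ _ ij) xi); rewrite ltxx.
have mphi B : measurable_fun (B : set (measurableTypeR R)) (v^\+ \o phi)%E.
  apply: measurable_funTS; apply: (@measurableT_comp _ _ _ _ borel).
    exact: measurable_valuation_pos.
  exact: measurable_expansion_limit.
have unifD n : unif (D n) = ((1 - q^-1) * q ^- n)%:E.
  rewrite /unif /= /mrestr (_ : D n `&` _ = D n).
    apply: (etrans (lebesgue_measure_itv _)).
    rewrite /= lte_fin ltf_pV2 ?posrE ?qn_gt0// ltr_eXn2l ?card_field_gt1//.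
    by rewrite ltnSn -EFinD mulrBl mul1r exprS invfM.
  apply/setIidPl => x; rewrite /D /= !in_itv/= => /andP[nx xn]; apply/andP; split.
    by rewrite (le_trans _ nx)// invr_ge0 ltW.
  by rewrite (lt_le_trans xn)// (le_trans (qV_le _ _ (leq0n _)))// expr0 invr1.
apply/eqP; rewrite -leye_eq.
(* The [D n] fill []0, 1[] and have length [(1 - q^-1) * q ^- n], so the integral is at least
   [1 - q^-1] times the series. *)
apply: (@le_trans _ _ (\int[unif]_(x in \bigcup_n D n) (v^\+ \o phi) x)%E); last first.
  apply: ge0_subset_integral => //; first exact: bigcupT_measurable.
  by move=> x _ /=.
rewrite ge0_integral_bigcup//; last by move=> x _ /=.
have q1 : 0 < 1 - q^-1.
  by rewrite subr_gt0 invf_lt1 ?card_field_gt1 ?card_field_gt0.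
apply: (@le_trans _ _ (\sum_(n <oo) ((1 - q^-1)%:E * (v^\+ (l n) * (q ^- n)%:E)))%E).
  rewrite nneseriesZl ?ser ?gt0_muley ?lte_fin// => n _.
  by rewrite mule_ge0// lee_fin invr_ge0 ltW.
apply: lee_nneseries => [n _ _|n _].
  by rewrite mule_ge0// ?mule_ge0// lee_fin ?invr_ge0 ltW.
apply: (@le_trans _ _ (\int[unif]_(x in D n) cst (v^\+ (l n)) x)%E).
  by rewrite integral_cst// unifD EFinM muleCA.
apply: ge0_le_integral => //; first by move=> x _ /=.
move=> x; rewrite /D /= in_itv/= => /andP[_ xn].
apply: valuation_pos_le; have := phiE x n; rewrite /expansion.
rewrite (_ : Num.trunc _ = 0%N) ?digit_sum0 ?subr0//.
by apply/truncn0Pn; rewrite -ltNge -ltr_pdivlMl// mulr1.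
Qed.

End Limit.

Lemma haar_of_reduced_basis K l : compact K -> is_subspace iota K ->
  reduced_basis iota K l ->
  (\sum_(n <oo) v^\+ (l n) * (q ^- n)%:E = +oo)%E ->
  valuation_integral_infinite K.
Proof.
move=> cK sK Kl ser; have [phi phiP] := expansion_limit cK sK Kl.
have phiK x := (phiP x).1; have phiE x := (phiP x).2.
have hmu := expansion_measure_haar Kl phiK phiE.
exists (expansion_measure Kl phiE) => //.
have [t _ Kt] := compact_bounded_Delta cK; case: hmu => _ muK _.
apply/(integral_valuation_posP _ muK Kt).
  by apply: closed_borel; exact: compact_closed_valued.
exact: expansion_measure_integral.
Qed.

End HaarConstruction.

(** * Descending bases and the class G *)

Section ScriptG.
Context {R : realType} {C : fieldType} {a : nonarch_absval R C}.
Local Notation Ca := (valued a).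
Local Notation v := (@valuation R C a).
Context {F : finFieldType} (iota : {rmorphism F -> Ca}).
Local Notation q := (#|F|%:R : R).
Implicit Types (x : Ca) (r t : R) (K G H : set Ca) (l : nat -> Ca).

(** The first implication applies to whichever Haar measure is given; the second exhibits the law of
    a random expansion. *)
Lemma valuation_integral_infiniteP K l : compact K -> is_subspace iota K ->
  reduced_basis iota K l -> valuation_integral_infinite K <->
  (\sum_(n <oo) v^\+ (l n) * (q ^- n)%:E = +oo)%E.
Proof.
move=> cK sK Kl; split => [[mu hmu]|].
  exact: (haar_integral_series cK sK Kl hmu).
exact: (haar_of_reduced_basis cK sK Kl).
Qed.

Lemma eq_coset K x y : is_subspace iota K -> K (x - y) ->
  [set x + z | z in K] = [set y + z | z in K].
Proof.
move=> sK Kxy; have [_ KD _] := sK.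
apply/seteqP; split => _ [z Kz <-].
  exists (x - y + z); first exact: KD.
  by rewrite addrA [y + _]addrC subrK.
exists (z - (x - y)); first exact: (subspaceB sK).
by rewrite opprB addrCA [x + _]addrC subrK addrC.
Qed.

Lemma coset_mem K x y : is_subspace iota K ->
  [set x + z | z in K] = [set y + z | z in K] -> K (x - y).
Proof.
move=> [K0 _ _] xy; have : [set x + z | z in K] x by exists 0; rewrite ?addr0.
by rewrite xy => -[z Kz <-]; rewrite addrC addKr.
Qed.

Lemma subspace_GDelta r G : 0 < r -> is_subspace iota G ->
  is_subspace iota (G `&` Delta r).
Proof. by move=> r0 sG; apply: subspaceI => //; apply: subspace_Delta; exact: ltW. Qed.

Lemma GDelta_cover_compact r t G (s : nat -> Ca) N : compact (G `&` Delta r) ->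
  (G `&` Delta t `<=` \bigcup_(i < N) [set s i + z | z in G `&` Delta r]) ->
  is_subspace iota G -> (forall i, G (s i)) ->
  compact (G `&` Delta t).
Proof.
move=> cGr cover [_ GD _] Gs.
rewrite (_ : _ `&` _ =
    (\bigcup_(i < N) [set s i + z | z in G `&` Delta r]) `&` Delta t).
  apply: compact_closedI; last exact: closed_Delta.
  by rewrite bigcup_mkord; apply: bigsetU_compact => i _; exact: compact_translate.
apply/seteqP; split => [x Gx|x [[i _ [z [Gz _] <-] xt]]].
  by split; [exact: cover|exact: Gx.2].
by split => //; exact: GD.
Qed.

(** Only finitely many cosets of G cap Delta_r meet [Delta t], so G cap Delta_t is the trace on
    [Delta t] of finitely many compact translates. *)
Lemma scriptG_compact r t G : 0 < r -> scriptG iota r G ->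
  compact (G `&` Delta t).
Proof.
move=> r0 [sG cGr _ fincount]; have sGr := subspace_GDelta r0 sG.
have G_coset x : G x -> [set x + z | z in G `&` Delta r] x.
  by move=> Gx; exists 0; rewrite ?addr0//; case: sGr.
case: fincount => [fin|[cnt tend]].
  apply: compact_closedI; last exact: closed_Delta.
  rewrite (_ : G = \bigcup_(A in cosets (G `&` Delta r) G) A); last first.
    apply/seteqP; split => [x Gx|x [_ [g Gg <-] [z [Gz _] <-]]].
      exists [set x + z | z in G `&` Delta r]; last exact: G_coset.
      by exists x.
    by case: sG => _ + _; exact.
  have /finite_seqP[s sE] := fin; rewrite sE bigcup_seq big_seq.
  apply: bigsetU_compact => A As.
  have : cosets (G `&` Delta r) G A by rewrite sE.
  by move=> [g _ <-]; exact: compact_translate.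
have /card_set_bijP[f [fG finj fsurj]] :
  ([set: nat] #= cosets (G `&` Delta r) G)%card by rewrite card_eq_sym.
have /choice[g gP] : forall n, exists x, G x /\
    [set x + z | z in G `&` Delta r] = f n.
  by move=> n; have [x Gx xf] := fG n I; exists x.
have grep : coset_representatives (G `&` Delta r) G g.
  split => [n|x Gx]; first exact: (gP n).1.
  have [|n _ fn] := fsurj [set x + z | z in G `&` Delta r]; first by exists x.
  have Kxg m : (G `&` Delta r) (x - g m) <-> f m = [set x + z | z in G `&` Delta r].
    rewrite -(gP m).2; split => [/eq_coset->//|/esym/coset_mem]; exact.
  exists n; split; first exact/Kxg.
  move=> m /Kxg fm; apply: finj; rewrite ?inE//.
  by rewrite fn fm.
(* If [x] lies in [Delta t] and in the coset of [g n], then [absv (g n)] is at most [Num.max t r];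
   adding 1 makes the comparison strict. *)
have /cvgryPge/(_ (Num.max t r + 1)) [N _ NP] := tend _ grep.
apply: (GDelta_cover_compact (s := g) (N := N)) cGr _ sG _ => [x [Gx xt]|i].
  have [n [[Gxg xg] _]] := grep.2 _ Gx; exists n; last first.
    by exists (x - g n); rewrite // addrC subrK.
  rewrite /= ltnNge; apply/negP => /NP/=; rewrite leNgt => /negP; apply.
  apply: (@le_lt_trans _ _ (Num.max t r)); last by rewrite ltrDl.
  rewrite -[g n](subKr x); apply: absvB_le; rewrite le_max; first by rewrite xt.
  by rewrite xg orbT.
exact: (gP i).1.
Qed.

(** Two representatives attached to the same point of a finite net of radius [r] differ by less than
    [r], hence represent the same coset. *)
Lemma finite_coset_reps r t G (g : nat -> Ca) : 0 < r -> is_subspace iota G ->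
  compact (G `&` Delta t) -> coset_representatives (G `&` Delta r) G g ->
  finite_set [set n | absv (g n) <= t].
Proof.
move=> r0 sG cGt [Gg grep]; have [s [_ sP]] := compact_net cGt r0.
have /choice[y yP] : forall n, exists y, absv (g n) <= t ->
    y \in s /\ absv (g n - y) < r.
  move=> n; have [gt|gt] := pselect (absv (g n) <= t); last by exists 0.
  by have [y ys gy] := sP _ (conj (Gg n) gt); exists y.
have yinj : {in [set n | absv (g n) <= t] &, injective y}.
  move=> m n /set_mem/= mt /set_mem/= nt ymn.
  have [k [_ kuniq]] := grep _ (Gg m).
  transitivity k; [apply/esym|]; apply: kuniq.
    by rewrite subrr; split; [case: sG|rewrite /Delta/= absv0 ltW].
  split; first exact: (subspaceB sG).
  apply/ltW; apply: absv_trans_lt (yP _ mt).2 _.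
  by rewrite ymn absvBC; exact: (yP _ nt).2.
rewrite -(eq_finite_set (inj_card_eq yinj)).
by apply: (@sub_finite_set _ _ [set` s]) => // _ [n nt <-]; exact: (yP _ nt).1.
Qed.

(** Trades the coset condition for compactness at every radius, leaving [r] only in the integral. *)
Lemma scriptGP r G : 0 < r -> is_subspace iota G ->
  scriptG iota r G <-> (forall t, compact (G `&` Delta t)) /\
    valuation_integral_infinite (G `&` Delta r).
Proof.
move=> r0 sG; split => [Gr|[cG intG]].
  by split => [t|]; [exact: scriptG_compact Gr|case: Gr].
have sGr := subspace_GDelta r0 sG.
split => //; have [fin|inf] := pselect (finite_set (cosets (G `&` Delta r) G)).
  by left.
right; split.
  apply: eq_card_nat => //.
  rewrite (_ : cosets _ _ = \bigcup_n
    [set [set g + x | x in G `&` Delta r] | g in G `&` Delta n%:R]); last first.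
    apply/seteqP; split => [_ [g Gg <-]|_ [n _ [g [Gg _] <-]]]; last by exists g.
    exists (Num.trunc (absv g)).+1 => //; exists g => //; split => //.
    by have /andP[_ /ltW] := truncn_itv (absv_ge0 g).
  apply: bigcup_countable => // n _; apply: finite_set_countable.
  have [s [sG' sP]] := compact_net (cG n%:R) r0.
  apply: (@sub_finite_set _ _
    [set [set g + x | x in G `&` Delta r] | g in [set` s]]); last exact: finite_image.
  move=> _ [g Gg <-]; have [y ys gy] := sP _ Gg; exists y => //.
  apply: eq_coset => //; split; last by rewrite /Delta/= absvBC ltW.
  by apply: (subspaceB sG); [exact: (sG' _ ys).1|exact: Gg.1].
move=> g grep; apply/cvgryPge => t.
have /finite_seqP[s sE] := finite_coset_reps r0 sG (cG t) grep.
exists (\max_(i <- s) i).+1 => // n /= sn; rewrite leNgt; apply/negP => /ltW gt.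
have : [set` s] n by rewrite -sE.
move=> /= ns; have := @leq_bigmax_seq _ s xpredT id n ns isT.
by rewrite leqNgt sn.
Qed.

End ScriptG.

(** * Series weighted by powers of 1/q *)

Section WeightedSeries.
Context {R : realType} {F : finFieldType}.
Local Notation q := (#|F|%:R : R).

Lemma weight_gt0 n : 0 < q ^- n :> R.
Proof. by rewrite invr_gt0 exprn_gt0// card_field_gt0. Qed.

(** Removing a finite first term and pulling out a factor 1/q do not affect divergence. The tail of
    a descending basis starts at an index that depends on the radius, whence the shift. *)
Lemma weighted_series_shift (f : nat -> \bar R) p : (forall n, 0 <= f n)%E ->
  (forall n, (n < p)%N -> f n < +oo)%E ->
  (\sum_(n <oo) f n * (q ^- n)%:E = +oo)%E <->
  (\sum_(n <oo) f (n + p)%N * (q ^- n)%:E = +oo)%E.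
Proof.
have term_ge0 (g : nat -> \bar R) : (forall n, 0 <= g n)%E ->
    forall n, (0 <= g n * (q ^- n)%:E)%E.
  by move=> g0 n; rewrite mule_ge0// lee_fin ltW// weight_gt0.
elim: p f => [|p ih] f f0 fp; first by under [in X in _ <-> X]eq_eseriesr do rewrite addn0.
have q0 : 0 < q^-1 by rewrite invr_gt0 card_field_gt0.
rewrite nneseries_recl//; last by move=> n _; exact: term_ge0.
rewrite expr0 invr1 mule1 -(nneseries_addn 1); last by move=> n; exact: term_ge0.
have -> : (\sum_(n <oo) f (n + 1)%N * (q ^- (n + 1))%:E =
    q^-1%:E * \sum_(n <oo) f (n.+1)%N * (q ^- n)%:E)%E.
  rewrite -nneseriesZl; last by move=> n _; exact: (term_ge0 (fun n => f n.+1)).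
  by apply: eq_eseriesr => n _; rewrite addn1 exprS invfM EFinM muleCA.
have := ih (fun n => f n.+1) (fun n => f0 _) (fun n np => fp n.+1 np).
under [in X in _ <-> X]eq_eseriesr do rewrite -addnS.
move=> <-; have ser0 : (0 <= \sum_(n <oo) f n.+1 * (q ^- n)%:E)%E.
  by apply: nneseries_ge0 => n _ _; exact: (term_ge0 (fun n => f n.+1)).
have f0fin : f 0%N \is a fin_num by rewrite ge0_fin_numE// fp.
rewrite -(fineK f0fin).
move: ser0; case: (limn _) => [s| |] //= _.
by rewrite gt0_muley ?lte_fin.
Qed.

Lemma sume_nat_subset (P : pred nat) (f : nat -> \bar R) N :
  (forall n, 0 <= f n)%E ->
  (\sum_(1 <= n < N | P n) f n <= \sum_(0 <= n < N) f n)%E.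
Proof.
move=> f0; case: N => [|N]; first by rewrite !big_geq.
apply: (@le_trans _ _ (\sum_(1 <= n < N.+1) f n)%E).
  by rewrite big_mkcond; apply: lee_sum => n _; case: ifP.
by rewrite [leRHS]big_ltn// leeDr.
Qed.

(** The correction [2 * q ^- N] makes the induction go through, by [2 <= q]; the resulting bound 2
    is the same for all q. *)
Lemma geometric_sum_le N : \sum_(0 <= n < N) q ^- n <= 2 - 2 * q ^- N.
Proof.
have q2 : 2 <= q by rewrite ler_nat card_finNzRing_gt1.
elim: N => [|N ih]; first by rewrite big_nil expr0 invr1 mulr1 subrr.
have qN : 2 * q ^- N.+1 <= q ^- N.
  rewrite exprS invfM mulrA ler_piMl//.
  by rewrite ler_pdivrMr ?mul1r// card_field_gt0.
rewrite big_nat_recr//=; lra.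
Qed.

Lemma geometric_sum_le2 N : \sum_(0 <= n < N) q ^- n <= 2.
Proof.
by rewrite (le_trans (geometric_sum_le N))// lerBlDr lerDl mulr_ge0.
Qed.

End WeightedSeries.

Lemma seq_int_max (s : seq int) (n0 : int) : n0 \in s ->
  exists2 m, m \in s & forall n, n \in s -> n <= m.
Proof.
elim: s n0 => // m s ih _ _; case: s ih => [_|k s ih].
  by exists m; [rewrite mem_head|move=> n; rewrite inE => /eqP->].
have [p ps pmax] := ih k (mem_head _ _).
case: (leP p m) => pm.
  exists m; first by rewrite mem_head.
  by move=> n; rewrite inE => /orP[/eqP->//|/pmax/le_trans]; exact.
exists p; first by rewrite inE ps orbT.
by move=> n; rewrite inE => /orP[/eqP->|/pmax//]; exact: ltW.
Qed.

Lemma set_int_min (A : set int) n0 b : A n0 -> (forall n, A n -> b <= n) ->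
  exists2 m, A m & forall n, A n -> m <= n.
Proof.
move=> An0 bA; have exk : exists k : nat, `[< A (b + k%:Z) >].
  by exists `|n0 - b|%N; apply/asboolP; rewrite gez0_abs ?subr_ge0 ?bA// subrKC.
case: (ex_minnP exk) => k /asboolP Ak kmin; exists (b + k%:Z) => // n An.
have nb : 0 <= n - b by rewrite subr_ge0 bA.
have /kmin : `[< A (b + `|n - b|%N%:Z) >].
  by apply/asboolP; rewrite gez0_abs// subrKC.
by rewrite -lez_nat gez0_abs// lerBrDl.
Qed.

(** * From a descending basis to the class G *)

Section DescendingToReduced.
Context {R : realType} {C : fieldType} {a : nonarch_absval R C}.
Local Notation Ca := (valued a).
Local Notation v := (@valuation R C a).
Context {F : finFieldType} (iota : {rmorphism F -> Ca}).
Local Notation q := (#|F|%:R : R).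
Implicit Types (x : Ca) (J : set int) (lam : int -> Ca).

Lemma span_family_gen J lam n : J n -> span_family iota J lam (lam n).
Proof.
move=> Jn; exists [:: n], (fun=> 1); split.
  by move=> m; rewrite inE => /eqP->.
by rewrite big_seq1 rmorph1 mul1r.
Qed.

Lemma span_family_uniq J lam x : span_family iota J lam x ->
  exists s c, [/\ uniq s, {in s, forall n, J n} &
    x = \sum_(n <- s) iota (c n) * lam n].
Proof.
move=> [s [c [sJ ->]]]; exists (undup s), (fun n => c n *+ count_mem n s).
split; [exact: undup_uniq|by move=> n; rewrite mem_undup; exact: sJ|].
rewrite -[LHS]big_undup_iterop_count; apply: eq_bigr => n _.
by rewrite rmorphMn mulrnAl Monoid.iteropE iter_addr_0.
Qed.

Lemma subspace_span_family J lam : is_subspace iota (span_family iota J lam).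
Proof.
split; first by exists [::], (fun=> 0); rewrite big_nil.
  move=> _ _ /span_family_uniq[s1 [c1 [u1 J1 ->]]] /span_family_uniq[s2 [c2 [u2 J2 ->]]].
  have restrict (s s' : seq int) (f : int -> Ca) : uniq s -> uniq s' ->
      {subset s' <= s} -> \sum_(n <- s | n \in s') f n = \sum_(n <- s') f n.
    move=> us us' ss'; rewrite -big_filter; apply/perm_big/uniq_perm => //.
      exact: filter_uniq.
    by move=> n; rewrite mem_filter; case: (boolP (n \in s')) => //= /ss'.
  exists (undup (s1 ++ s2)), (fun n => (if n \in s1 then c1 n else 0) +
    (if n \in s2 then c2 n else 0)); split.
    by move=> n; rewrite mem_undup mem_cat => /orP[/J1|/J2].
  rewrite -(restrict (undup (s1 ++ s2)) s1) ?undup_uniq//; last first.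
    by move=> n ns; rewrite mem_undup mem_cat ns.
  rewrite -(restrict (undup (s1 ++ s2)) s2) ?undup_uniq//; last first.
    by move=> n ns; rewrite mem_undup mem_cat ns orbT.
  rewrite !(big_mkcond (fun n => n \in _))/= -big_split/=; apply: eq_bigr => n _.
  by rewrite rmorphD mulrDl; congr +%R; case: ifP; rewrite ?rmorph0 ?mul0r.
move=> u _ [s [c [sJ ->]]]; exists s, (fun n => u * c n); split => //.
by rewrite mulr_sumr; apply: eq_bigr => n _; rewrite rmorphM mulrA.
Qed.

Section Basis.
Variables (J : set int) (lam : int -> Ca) (G : set Ca).
Hypotheses (sG : is_subspace iota G) (basis : is_descending_basis iota J lam G).

Let Jint m n k : J m -> J k -> m <= n <= k -> J n.
Proof. by case: basis => + _ _ _ _; exact. Qed.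

Let lam0 n : J n -> lam n != 0.
Proof. by case: basis => _ _ + _ _ => /(_ n)/[apply]-[]. Qed.

Let lam_min m x : J m -> span_family iota [set n | J n /\ n <= m] lam x ->
  x != 0 -> absv (lam m) <= absv x.
Proof. by case: basis => _ _ + _ _ => /(_ m)/[apply]-[_]; exact. Qed.

Let Glam n : J n -> G (lam n).
Proof.
by case: basis => _ [_ <-] _ _ _ Jn; apply: subset_closure; exact: span_family_gen.
Qed.

Lemma descending_nonincr m n : J m -> J n -> m <= n -> absv (lam n) <= absv (lam m).
Proof. by move=> Jm Jn mn; apply: lam_min => //; [exact: span_family_gen|exact: lam0]. Qed.

(** If [J] has no right end and [absv (lam n)] stayed at least [e], the valuations would be bounded
    by some [M] and the weighted sums by [M * 2], against condition (d). *)
Lemma descending_small e : 0 < e ->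
  exists M, forall n, J n -> M <= n -> absv (lam n) < e.
Proof.
move=> e0; case: (basis) => _ _ _ _ [[b bJ]|ser].
  exists (b + 1) => n Jn /lt_le_trans; move=> /(_ b); rewrite ltrDl => /(_ isT).
  by rewrite ltNge bJ.
apply: contrapT => /forallNP h.
have lam_ge n : J n -> e <= absv (lam n).
  move=> Jn; have /existsNP[m /not_implyP[Jm /not_implyP[nm /negP]]] := h n.
  by rewrite -leNgt => /le_trans; apply; exact: descending_nonincr.
pose M := Num.max 0 (- ln e).
have M0 : 0 <= M by rewrite le_max lexx.
have vM n : J n -> (v (lam n) <= M%:E)%E.
  move=> Jn; rewrite valuationE ?lam0// lee_fin le_max; apply/orP; right.
  by rewrite lerN2 ler_ln ?posrE ?absv_gt0 ?lam0// lam_ge.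
move/cvgeyPge: ser => /(_ (M * 2 + 1))[N _ /(_ _ (leqnn N))/=].
rewrite leNgt => /negP; apply.
apply: (@le_lt_trans _ _ (\sum_(0 <= n < N) (M * q ^- n)%:E)%E).
  apply: (@le_trans _ _ (\sum_(1 <= n < N | n%:Z \in J) (M * q ^- n)%:E)%E).
    apply: lee_sum => n /set_mem Jn; by rewrite EFinM lee_wpmul2r ?vM.
  by apply: sume_nat_subset => n; rewrite lee_fin mulr_ge0.
rewrite sumEFin lte_fin -mulr_sumr; apply: (@le_lt_trans _ _ (M * 2)).
  by rewrite ler_wpM2l// geometric_sum_le2.
by rewrite ltrDl.
Qed.

Lemma descending_start t : 0 < t -> exists m0,
  (forall n, J n -> absv (lam n) <= t <-> m0 <= n) /\
  (forall n, J n -> m0 <= n -> J m0).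
Proof.
move=> t0; have [M MP] := descending_small t0.
have [[n0 [Jn0 n0t]]|noJ] := pselect (exists n, J n /\ absv (lam n) <= t); last first.
  have noM n : J n -> ~ M <= n.
    by move=> Jn /(MP _ Jn)/ltW nt; apply: noJ; exists n.
  (* No vector lies in [Delta t]: [m0] is taken past the end of [J], and the tail is empty. *)
  exists M; split => n Jn; last by move=> /(noM _ Jn).
  by split => [nt|/(noM _ Jn)//]; exfalso; apply: noJ; exists n.
have [b bP] : exists b, forall n, J n /\ absv (lam n) <= t -> b <= n.
  case: (basis) => _ _ _ [[b bJ]|tend] _; first by exists b => n [/bJ].
  have /cvgryPge/(_ (t + 1))[N _ NP] := tend.
  exists (- N%:Z) => n [Jn nt]; rewrite leNgt; apply/negP => nN.
  have n0' : 0 <= - n by rewrite oppr_ge0 (le_trans (ltW nN))// oppr_le0.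
  have := NP `|n|%N; rewrite /= -lez_nat -abszN gez0_abs// lerNr ltW// => /(_ isT).
  by rewrite opprK leNgt (le_lt_trans nt)// ltrDl.
have [m0 [Jm0 m0t] m0min] := set_int_min (A := [set n | J n /\ absv (lam n) <= t])
  (conj Jn0 n0t) bP.
exists m0; split => // n Jn; split => [nt|m0n]; first exact: m0min.
by rewrite (le_trans _ m0t)// descending_nonincr.
Qed.

(* Beyond the right end of [J] the tail is padded with 0. *)
Definition tail_basis (m0 : int) (k : nat) : Ca :=
  if `[< J (m0 + k%:Z) >] then lam (m0 + k%:Z) else 0.

Lemma tail_lam m0 n : J n -> m0 <= n -> lam n = tail_basis m0 `|n - m0|%N.
Proof.
by move=> Jn mn; rewrite /tail_basis gez0_abs ?subr_ge0// subrKC asboolT.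
Qed.

Lemma tail_reduced t m0 : 0 < t ->
  (forall n, J n -> absv (lam n) <= t <-> m0 <= n) ->
  (forall n, J n -> m0 <= n -> J m0) ->
  reduced_basis iota (G `&` Delta t) (tail_basis m0).
Proof.
move=> t0 m0t m0J; have [G0 GD GZ] := sG.
have Jle k i : J (m0 + k%:Z) -> (i <= k)%N -> J (m0 + i%:Z).
  move=> Jk ik; have Jm0 : J m0 by apply: m0J Jk _; rewrite lerDl.
  by apply: Jint Jm0 Jk _; rewrite lerDl lerD2l !lez_nat ik.
split.
- move=> k; rewrite /tail_basis; case: asboolP => [Jk|_]; last first.
    by split => //; rewrite /Delta/= absv0 ltW.
  by split; [exact: Glam|apply/(m0t _ Jk); rewrite lerDl].
- move=> k _ [c _ <-]; rewrite {1}/tail_basis; case: asboolP => [Jk|_]; last first.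
    by rewrite absv0 absv_ge0.
  (* Coefficients on [lam] of [tail_basis m0 k] minus a combination of its predecessors; the
     coefficient 1 lets freeness show that this vector is nonzero, so that condition (b) applies. *)
  pose d n := if n == m0 + k%:Z then 1 else - c `|n - m0|%N.
  pose s := [seq m0 + i%:Z | i <- index_iota 0 k.+1].
  have us : uniq s.
    by rewrite map_inj_uniq ?iota_uniq// => i j /addrI[].
  have sJ n : n \in s -> J n /\ n <= m0 + k%:Z.
    move=> /mapP[i]; rewrite mem_index_iota/= => ik ->.
    by rewrite lerD2l lez_nat -ltnS; split => //; exact: (Jle k).
  have sumE : tail_basis m0 k - comb iota (tail_basis m0) k c =
      \sum_(n <- s) iota (d n) * lam n.
    rewrite /s big_map big_nat_recr//= /d eqxx rmorph1 mul1r {1}/tail_basis asboolT//.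
    rewrite addrC; congr +%R; rewrite /comb -sumrN big_mkord.
    apply: eq_bigr => i _; rewrite (inj_eq (addrI m0)) eqz_nat.
    rewrite ltn_eqF// addrC addKr /= rmorphN mulNr /tail_basis asboolT//.
    by apply: (Jle k) => //; exact: ltnW.
  apply: lam_min => //.
    by exists s, d; split => // n /sJ.
  apply/eqP => sum0; case: basis => _ [free _] _ _ _.
  have := free s d us (fun n ns => (sJ n ns).1).
  rewrite -sumE sum0 => /(_ erefl (m0 + k%:Z)).
  have ks : m0 + k%:Z \in s by apply/mapP; exists k; rewrite ?mem_index_iota ?ltnSn.
  by rewrite /d eqxx => /(_ ks)/eqP; rewrite oner_eq0.
- move=> k x [Gx xt].
  (* [G] is only the closure of the span, so the approximation is first obtained up to an error
     [e]. *)
  have net e : 0 < e -> e <= t -> exists2 w, initspan iota (tail_basis m0) k w &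
      absv (x - w) <= Num.max (absv (tail_basis m0 k)) e.
    move=> e0 et; case: basis => _ [_ GE] _ _ _.
    move: Gx; rewrite -GE => /closure_absvP/(_ _ e0)[y ys xy].
    have [s [c [us sJ yE]]] := span_family_uniq ys.
    have yt : absv y <= t.
      rewrite -[y](subKr x); apply: absvB_le => //.
      by rewrite (le_trans (ltW xy)).
    pose part P := \sum_(n <- s | P n) iota (c n) * lam n.
    have y_split : y = part (fun n => n < m0) + part (fun n => ~~ (n < m0)).
      by rewrite yE (bigID (fun n => n < m0)).
    (* If nonzero, the part before [m0] would by condition (b) be at least as long as its last
       vector, hence longer than [t]; yet it is [y] minus a part in [Delta t]. *)
    have u0 : part (fun n => n < m0) = 0.
      apply/eqP; apply: contrapT => /negP u0.
      have : absv (part (fun n => n < m0)) <= t.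
        rewrite -[part _](addrK (part (fun n => ~~ (n < m0)))) -y_split.
        apply: absvB_le => //; apply: absv_sum_le => [|n ns]; first exact: ltW.
        rewrite -leNgt => mn; rewrite (le_trans (absv_iotaM_le _ _ _))//.
        exact/(m0t _ (sJ _ ns)).
      have [sm sme] : exists sm, sm = [seq n <- s | n < m0] by eexists.
      have [n0 n0s] : exists n, n \in sm.
        case: sm sme => [sme|n sm _]; last by exists n; rewrite mem_head.
        by move: u0; rewrite /part -big_filter -sme big_nil eqxx.
      have [m ms mmax] := seq_int_max n0s.
      move: ms; rewrite sme mem_filter => /andP[mm0 /sJ Jm].
      apply/negP; rewrite -ltNge; apply: (@lt_le_trans _ _ (absv (lam m))).
        by rewrite ltNge; apply/negP => /(m0t _ Jm); rewrite leNgt mm0.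
      apply: lam_min => //; exists sm, c; rewrite /part -big_filter -sme; split => //.
      move=> n nsm; split; last exact: mmax.
      by move: nsm; rewrite sme mem_filter => /andP[_ /sJ].
    exists (\sum_(n <- s | (m0 <= n) && (n < m0 + k%:Z)) iota (c n) * lam n).
      apply: subspace_sum => [|n ns /andP[mn nk]].
        exact: subspace_initspan.
      have [_ _] := subspace_initspan iota (tail_basis m0) k; apply.
      rewrite (tail_lam (sJ _ ns) mn); apply: initspan_gen.
      by rewrite -ltz_nat gez0_abs ?subr_ge0// ltrBlDl.
    have -> : x - \sum_(n <- s | (m0 <= n) && (n < m0 + k%:Z)) iota (c n) * lam n =
        (x - y) + \sum_(n <- s | (m0 <= n) && ~~ (n < m0 + k%:Z)) iota (c n) * lam n.
      have -> : y = part (fun n => m0 <= n).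
        by rewrite y_split u0 add0r; apply: eq_bigl => n; rewrite -leNgt.
      by rewrite [part _](bigID (fun n => n < m0 + k%:Z))/= opprD addrA subrK.
    apply: absvD_le; first by rewrite le_max (ltW xy) orbT.
    rewrite le_max; apply/orP; left; apply: absv_sum_le => [|n ns /andP[mn]].
      exact: absv_ge0.
    rewrite -leNgt => kn; rewrite (le_trans (absv_iotaM_le _ _ _))//.
    have Jn := sJ _ ns.
    have Jk : J (m0 + k%:Z).
      by apply: Jint (m0J _ Jn mn) Jn _; rewrite lerDl kn.
    by rewrite /tail_basis asboolT//; exact: descending_nonincr.
  (* The span is finite, so it has a point [w] nearest to [x]. Were [w] too far, an error at most
     halfway between [absv (tail_basis m0 k)] and [absv (x - w)] would produce a nearer point. *)
  have [ws wsE] := initspan_seq iota (tail_basis m0) k.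
  have [w0 w0s _] := net _ t0 (lexx _).
  have [w ws' wmin] := nearest_point x ((wsE _).1 w0s).
  exists w; first exact/wsE.
  rewrite leNgt; apply/negP => lw.
  pose e := Num.min t ((absv (x - w) + absv (tail_basis m0 k)) / 2).
  have e0 : 0 < e.
    rewrite lt_min t0 divr_gt0// ltr_wpDr ?absv_ge0//.
    exact: le_lt_trans (absv_ge0 _) lw.
  have [|w' /wsE w's xw'] := net e e0; first by rewrite ge_min lexx.
  have := le_trans (wmin _ w's) xw'; rewrite leNgt => /negP; apply.
  rewrite gt_max lw/= (le_lt_trans (_ : e <= (absv (x - w) + absv (tail_basis m0 k)) / 2))//.
    by rewrite ge_min lexx orbT.
  by lra.
- move=> e e0; have [M MP] := descending_small e0.
  exists `|M - m0|%N; rewrite /tail_basis; case: asboolP => [Jk|_]; last by rewrite absv0.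
  by apply: MP => //; rewrite -lerBlDl abszE ler_norm.
Qed.

(** If the tail reaches the padding, one term is infinite. Otherwise [J] has no right end, condition
    (d) makes the series of positive parts over nonnegative indices diverge, and the start is moved
    to [m0]. *)
Lemma tail_series m0 : (forall n, J n -> m0 <= n -> J m0) ->
  (\sum_(k <oo) v^\+ (tail_basis m0 k) * (q ^- k)%:E = +oo)%E.
Proof.
move=> m0J; have term_ge0 (f : nat -> Ca) k : (0 <= v^\+ (f k) * (q ^- k)%:E)%E.
  by rewrite mule_ge0// lee_fin.
have [[k tk0]|/forallNP tN0] := pselect (exists k, tail_basis m0 k = 0).
  apply: (nneseries_pinfty (k := k)) => //.
  by rewrite tk0 valuation_pos0 mulyr gtr0_sg ?mul1e ?weight_gt0.
have Jk k : J (m0 + k%:Z).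
  by apply: contrapT => nJ; apply: (tN0 k); rewrite /tail_basis asboolF.
have tail_fin k : (v^\+ (tail_basis m0 k) < +oo)%E.
  by apply: valuation_pos_fin; apply/eqP.
pose f n := if `[< J n%:Z >] then (v^\+ (lam n%:Z))%E else 0%E.
have f0 n : (0 <= f n)%E by rewrite /f; case: ifP.
have fser : (\sum_(n <oo) f n * (q ^- n)%:E = +oo)%E.
  apply/eqP; rewrite -leye_eq.
  case: (basis) => _ _ _ _ [[b bJ]|ser].
    pose k : int := (b : int) + 1 - m0.
    have := bJ _ (Jk `|k|%N); rewrite leNgt => /negP; case.
    by rewrite -lezD1 -lerBlDl abszE ler_norm.
  rewrite -(cvg_lim _ ser)//; apply: lime_le; first by apply/cvg_ex; exists +oo%E.
  apply: nearW => N.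
  apply: (@le_trans _ _ (\sum_(0 <= n < N) f n * (q ^- n)%:E)%E); last first.
    by apply: nneseries_lim_ge => n _; rewrite mule_ge0// lee_fin.
  apply: (@le_trans _ _
    (\sum_(1 <= n < N | n%:Z \in J) f n * (q ^- n)%:E)%E); last first.
    by apply: sume_nat_subset => n; rewrite mule_ge0// lee_fin.
  apply: lee_sum => n /set_mem Jn; rewrite lee_wpmul2r ?lee_fin//.
  by rewrite /f asboolT// funeposE le_max lexx.
have ffin n : (f n < +oo)%E.
  rewrite /f; case: asboolP => // Jn; apply: valuation_pos_fin; exact: lam0.
(* For [m0 >= 0] the tail is [f] without its first [m0] terms; for [m0 < 0] it is [f] that is a
   shift of the tail. *)
case: m0 m0J tN0 Jk tail_fin => p m0J tN0 Jk tail_fin.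
  move/(weighted_series_shift (p := p) f0 (fun n _ => ffin n)): fser => <-.
  by apply: eq_eseriesr => k _; rewrite /f /tail_basis addnC PoszD !asboolT.
apply/(weighted_series_shift (f := fun k => (v^\+ (tail_basis (Negz p) k))%E) (p := p.+1)) => //.
rewrite -fser; apply: eq_eseriesr => k _; have := Jk (k + p.+1)%N; rewrite /f /tail_basis.
have -> : Negz p + (k + p.+1)%N%:Z = k%:Z by rewrite NegzE PoszD addrC addrK.
by move=> Jk'; rewrite !asboolT.
Qed.

Lemma descending_scriptG r : is_complete a -> 0 < r -> scriptG iota r G.
Proof.
move=> cpl r0; have clG : closed G.
  by case: (basis) => _ [_ <-] _ _ _; exact: closed_closure.
have cG t : compact (G `&` Delta t).
  (* [t] may be 0 or negative, so compactness is proved at a positive radius and then cut down. *)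
  have rt0 : 0 < Num.max r t by rewrite lt_max r0.
  have [m0 [m0t m0J]] := descending_start rt0.
  rewrite (_ : G `&` Delta t = (G `&` Delta (Num.max r t)) `&` Delta t).
    apply: compact_closedI; last exact: closed_Delta.
    apply: (reduced_basis_compact cpl); first by apply: closedI => //; exact: closed_Delta.
    exact: tail_reduced m0t m0J.
  rewrite -setIA; congr (_ `&` _); apply/seteqP; split => x; last by case.
  by rewrite /Delta/= => xt; split => //; rewrite le_max xt orbT.
apply/scriptGP => //; split => //.
have [m0 [m0t m0J]] := descending_start r0.
apply/(valuation_integral_infiniteP (cG r) _ (tail_reduced r0 m0t m0J)).
  exact: subspace_GDelta.
exact: tail_series.
Qed.

End Basis.

End DescendingToReduced.

(** * From a reduced basis of one ball to a descending basis *)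

Section ReducedToDescending.
Context {R : realType} {C : fieldType} {a : nonarch_absval R C}.
Local Notation Ca := (valued a).
Local Notation v := (@valuation R C a).
Context {F : finFieldType} (iota : {rmorphism F -> Ca}).
Local Notation q := (#|F|%:R : R).
Variables (G : set Ca) (r : R) (l : nat -> Ca).
Hypotheses (r0 : 0 < r) (sG : is_subspace iota G).
Hypothesis cG : forall t, compact (G `&` Delta t).
Hypothesis Kl : reduced_basis iota (G `&` Delta r) l.
Hypothesis lser : (\sum_(n <oo) v^\+ (l n) * (q ^- n)%:E = +oo)%E.
Implicit Types (x y : Ca) (mu : nat -> Ca).

Lemma closed_of_compact_Delta : closed G.
Proof.
move=> x /closure_absvP clx; pose t := Num.max (absv x) 1.
have : closure (G `&` Delta t) x.
  apply/closure_absvP => e e0; have [|y Gy xy] := clx (Num.min e 1).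
    by rewrite lt_min e0 ltr01.
  exists y; last by rewrite (lt_le_trans xy)// ge_min lexx.
  split => //; rewrite /Delta/= -[y](subKr x); apply: absvB_le.
    by rewrite le_max lexx.
  by rewrite (le_trans (ltW xy))// ge_min; apply/orP; right; rewrite le_max lexx orbT.
by move=> /(compact_closed_valued (@cG t))[].
Qed.

Let sK : is_subspace iota (G `&` Delta r) := subspace_GDelta r0 sG.

(** The sum of the span of the first [n] minima and G cap Delta_r: minima are sought modulo the ball
    that [l] already describes. *)
Let cospan mu n : set Ca := [set x | exists2 w, initspan iota mu n w &
  (G `&` Delta r) (x - w)].

Let cospan_subspace mu n : is_subspace iota (cospan mu n).
Proof.
have [W0 WD WZ] := subspace_initspan iota mu n; have [K0 KD KZ] := sK.
split; first by exists 0; rewrite ?subr0.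
- move=> x y [w Ww Kw] [w' Ww' Kw']; exists (w + w'); first exact: WD.
  by rewrite opprD addrACA; exact: KD.
- by move=> u x [w Ww Kw]; exists (iota u * w); [exact: WZ|rewrite -mulrBr; exact: KZ].
Qed.

Let cospan_gen mu n i : (i < n)%N -> cospan mu n (mu i).
Proof.
by move=> ni; exists (mu i); [exact: initspan_gen|rewrite subrr; case: sK].
Qed.

Let cospan_K mu n : G `&` Delta r `<=` cospan mu n.
Proof.
by move=> x Kx; exists 0; [case: (subspace_initspan iota mu n)|rewrite subr0].
Qed.

Let cospan_le mu m n : (m <= n)%N -> cospan mu m `<=` cospan mu n.
Proof. by move=> mn x [w /(initspan_le mn) Ww Kw]; exists w. Qed.

Let cospan_sub mu n : (forall i, (i < n)%N -> G (mu i)) -> cospan mu n `<=` G.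
Proof.
move=> Gmu x [w Ww [Gxw _]]; rewrite -(subrK w x).
by case: (sG) => _ + _; apply => //; exact: initspan_sub Ww.
Qed.

(* [x = 0] encodes that [G] is exhausted. *)
Let minimum_outside mu n x :=
  (G `<=` cospan mu n /\ x = 0) \/
  [/\ G x, ~ cospan mu n x &
    forall y, G y -> ~ cospan mu n y -> absv x <= absv y].

Let minimum_outside_exists mu n : (forall i, (i < n)%N -> G (mu i)) ->
  exists x, minimum_outside mu n x.
Proof.
move=> Gmu.
have [GW|/existsNP[y0 /not_implyP[Gy0 Wy0]]] := pselect (G `<=` cospan mu n).
  by exists 0; left.
(* Since [cospan mu n] contains G cap Delta_r, a point of [G] outside it is at distance at least [r]
   from it. This closed form of the condition makes [A] compact. *)
pose A := (G `&` Delta (absv y0)) `&` [set y | forall w, cospan mu n w -> r <= absv (y - w)].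
have AP y : G y -> ~ cospan mu n y -> absv y <= absv y0 -> A y.
  move=> Gy Wy yy0; split => // w Ww; rewrite leNgt; apply/negP => yw.
  apply: Wy; rewrite -(subrK w y); have [_ WD _] := cospan_subspace mu n.
  apply: WD => //; apply: cospan_K; split; last exact: ltW.
  by apply: (subspaceB sG) => //; exact: cospan_sub Ww.
have cA : compact A.
  apply: compact_closedI => // x /closure_absvP clx w Ww.
  have [y yA xy] := clx _ r0.
  rewrite -[x - w](subrKA y) addrC absv_dominant ?yA//.
  exact: lt_le_trans xy (yA _ Ww).
have [||x /set_mem[[Gx xy0] xW] xmin] := @compact_EVT_min _ _ (@absv R C a) A _ cA.
- by exists y0; exact: AP.
- exact/continuous_subspaceT/continuous_absv.
exists x; right; split => //.
  by move=> /xW; rewrite subrr absv0 leNgt r0.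
move=> y Gy Wy; case: (leP (absv y) (absv y0)) => [yy0|/ltW]; last exact: le_trans.
by apply: xmin; apply/mem_set; exact: AP.
Qed.

Lemma successive_minima : exists mu, forall n, G (mu n) /\ minimum_outside mu n (mu n).
Proof.
have [n mu|n mu mu' x mumu' P Gmu'|mu muP] := @dependent_choice_prefix Ca 0
  (fun n mu x => (forall i, (i < n)%N -> G (mu i)) -> minimum_outside mu n x).
- have [Gmu|nG] := pselect (forall i, (i < n)%N -> G (mu i)); last by exists 0.
  by have [x xP] := minimum_outside_exists Gmu; exists x.
- rewrite /minimum_outside; have -> : cospan mu' n = cospan mu n.
    by rewrite /cospan (initspan_ext _ mumu').
  by apply: P => i ni; rewrite mumu'//; exact: Gmu'.
have Gmu n : G (mu n).
  elim/ltn_ind : n => n /(muP n)[[_ ->]|[]//]; by case: sG.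
by exists mu => n; split => //; exact: muP.
Qed.

Section Basis.
Variable mu : nat -> Ca.
Hypothesis Gmu : forall n, G (mu n).
Hypothesis mu_min : forall n, minimum_outside mu n (mu n).

Lemma minima_eq0 n : mu n = 0 -> G `<=` cospan mu n.
Proof.
have [[]//|[_ Wmu _]] := mu_min n.
by move=> mu0; exfalso; apply: Wmu; rewrite mu0; case: (cospan_subspace mu n).
Qed.

Lemma minima_outside m n : (m <= n)%N -> mu n != 0 -> ~ cospan mu m (mu n).
Proof.
move=> mn mun0 /(cospan_le mn); have [[_ /eqP]|[]//] := mu_min n.
by rewrite (negbTE mun0).
Qed.

Lemma minima_neq0 m n : (m <= n)%N -> mu n != 0 -> mu m != 0.
Proof.
move=> mn mun0; apply/eqP => /minima_eq0 GW.
by apply: (minima_outside mn mun0); exact: GW.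
Qed.

Lemma minima_le n y : mu n != 0 -> G y -> ~ cospan mu n y -> absv (mu n) <= absv y.
Proof. by move=> mun0; have [[_ /eqP]|[_ _]] := mu_min n; [rewrite (negbTE mun0)|exact]. Qed.

Lemma minima_nondecr m n : (m <= n)%N -> mu n != 0 -> absv (mu m) <= absv (mu n).
Proof.
by move=> mn mun0; apply: minima_le => //; [exact: minima_neq0 mun0|exact: minima_outside].
Qed.

Lemma minima_gt n : mu n != 0 -> r < absv (mu n).
Proof.
move=> mun0; rewrite ltNge; apply/negP => mur.
by apply: (minima_outside (leqnn n) mun0); apply: cospan_K.
Qed.

(** [cospan mu n] contains every point of [G] within [r] of an earlier minimum, so the minima are
    [r]-separated and cannot stay in a compact ball. *)
Lemma minima_unbounded t : (forall n, mu n != 0) -> exists n, t < absv (mu n).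
Proof.
move=> mu0; apply: contrapT => /forallNP mut.
have {}mut n : absv (mu n) <= t by rewrite leNgt; apply/negP.
apply: (compact_not_separated (@cG t) r0 (u := mu)) => [n|m n mn].
  by split => //; exact: mut.
rewrite leNgt; apply/negP => mnr; apply: (minima_outside (leqnn n) (mu0 n)).
rewrite -[mu n](subKr (mu m)); apply: (subspaceB (cospan_subspace mu n)).
  exact: cospan_gen.
by apply: cospan_K; split; [exact: (subspaceB sG)|exact: ltW].
Qed.

Lemma minima_exhaust x : G x -> exists n, cospan mu n x.
Proof.
move=> Gx; have [[n /minima_eq0 GW]|/forallNP mu0] := pselect (exists n, mu n = 0).
  by exists n; exact: GW.
have {}mu0 n : mu n != 0 by apply/eqP.
have [n xn] := minima_unbounded (absv x) mu0; exists n; apply: contrapT => Wx.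
by have := minima_le (mu0 n) Gx Wx; rewrite leNgt xn.
Qed.

(** [Negz k] is [- k.+1]: the minima run leftwards from -1, the reduced basis rightwards from 0.
    Zeros mark where a sequence has ended, and [J] removes them. *)
Definition two_sided (n : int) : Ca :=
  match n with Posz k => l k | Negz k => mu k end.

Let J : set int := [set n | two_sided n != 0].

Lemma reduced_neq0 m n : (m <= n)%N -> l n != 0 -> l m != 0.
Proof.
move=> mn; rewrite -!absv_gt0 => /lt_le_trans; apply.
exact: (reduced_basis_nonincr Kl).
Qed.

Lemma two_sided_nonincr m n : J m -> J n -> m <= n ->
  absv (two_sided n) <= absv (two_sided m).
Proof.
case: m n => [m|m] [n|n] //= Jm Jn mn.
- exact: (reduced_basis_nonincr Kl).
- have [/(_ n)[_ lr] _ _ _] := Kl; exact: le_trans lr (ltW (minima_gt Jm)).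
- by apply: minima_nondecr => //; move: mn; rewrite !NegzE lerN2 lez_nat.
Qed.

(** If a negative index has a nonzero coefficient, the leftmost such index decides: the sum lies
    outside its [cospan], and minimality applies. Otherwise the rightmost one decides, by
    orthogonality in [l]. *)
Lemma two_sided_ge s c m n : uniq s -> {in s, forall n, J n /\ n <= m} -> J m ->
  n \in s -> c n != 0 ->
  absv (two_sided m) <= absv (\sum_(n <- s) iota (c n) * two_sided n).
Proof.
move=> us sJ Jm ns cn; set x := \sum_(n <- s) _.
pose s' := [seq n <- s | c n != 0].
have ns' : n \in s' by rewrite mem_filter cn ns.
have s'P k : k \in s' -> [/\ k \in s, c k != 0, J k & k <= m].
  by rewrite mem_filter => /andP[ck ks]; have [] := sJ _ ks.
have [n1 n1s' n1max] := seq_int_max ns'.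
have [n0 n0s' n0min] : exists2 n0, n0 \in s' & forall k, k \in s' -> n0 <= k.
  have [|k ks kmax] := @seq_int_max [seq - k | k <- s'] (- n).
    by rewrite map_f.
  have /mapP[n0 n0s kE] := ks; exists n0 => // j js.
  by rewrite -lerN2 -kE; apply: kmax; rewrite map_f.
have sum_in (S : set Ca) j : is_subspace iota S -> j \in s' ->
    (forall k, k \in s' -> k != j -> S (two_sided k)) ->
    exists2 w, S w & x = iota (c j) * (two_sided j - w).
  move=> sS js' Sk; have [js cj _ _] := s'P _ js'.
  have icj : iota (c j) != 0 by rewrite fmorph_eq0.
  exists (iota (- (c j)^-1) * \sum_(k <- s | k != j) iota (c k) * two_sided k).
    case: (sS) => S0 _ SZ; apply: (SZ); apply: (subspace_sum sS) => k ks kj.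
    have [->|ck] := eqVneq (c k) 0; first by rewrite rmorph0 mul0r.
    by apply: SZ; apply: Sk => //; rewrite mem_filter ck.
  rewrite rmorphN fmorphV mulrBr mulNr mulrN opprK mulrA divff// mul1r.
  by rewrite /x (bigD1_seq j).
case: n0 n0s' n0min => [p|k] n0s' n0min; last first.
  have [_ ck Jk km] := s'P _ n0s'.
  have [|j js' jk|w Ww xE] := sum_in (cospan mu k) (Negz k) _ n0s'.
  - exact: cospan_subspace.
  - case: j js' jk => [j|j] js' jk /=; last first.
      apply: cospan_gen; rewrite ltn_neqAle; apply/andP; split.
        by apply: contraNneq jk => ->.
      by have := n0min _ js'; rewrite !NegzE lerN2 lez_nat.
    by apply: cospan_K; case: Kl.
  apply: le_trans (two_sided_nonincr Jk Jm km) _ => /=.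
  apply: minima_le => //.
    apply: (subspace_sum sG) => j js _; case: (sG) => _ _; apply.
    by case: j js => //= j _; have [/(_ j)[]] := Kl.
  rewrite xE => Wx; apply: (minima_outside (leqnn k) Jk).
  rewrite -(subrK w (mu k)); have [_ WD WZ] := cospan_subspace mu k.
  apply: WD => //; have := WZ (c (Negz k))^-1 _ Wx.
  by rewrite mulrA -rmorphM mulVf// rmorph1 mul1r.
case: n1 n1s' n1max => [p1|p1] n1s' n1max; last first.
  by have := n0min _ n1s'.
have [_ cp Jp pm] := s'P _ n1s'.
have [|j js' jp|w Ww xE] := sum_in (initspan iota l p1) (Posz p1) _ n1s'.
- exact: subspace_initspan.
- case: j js' jp => [j|j] js' jp /=; last by have := n0min _ js'.
  apply: initspan_gen; rewrite ltn_neqAle; apply/andP; split.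
    by apply: contraNneq jp => ->.
  by have := n1max _ js'.
apply: le_trans (two_sided_nonincr Jp Jm pm) _ => /=.
by rewrite xE absv_iotaM//; have [_ + _ _] := Kl; exact.
Qed.

Lemma two_sided_closure : closure (span_family iota J two_sided) = G.
Proof.
have Gts n : G (two_sided n).
  by case: n => n //=; have [/(_ n)[]] := Kl.
have spants n : span_family iota J two_sided (two_sided n).
  have [n0|n0] := eqVneq (two_sided n) 0; last exact: span_family_gen.
  by rewrite n0; case: (subspace_span_family iota J two_sided).
apply/seteqP; split => [x /closure_absvP clx|x Gx].
  apply: closed_of_compact_Delta; apply/closure_absvP => e /clx[_ [s [c [_ ->]]] xe].
  exists (\sum_(n <- s) iota (c n) * two_sided n) => //.
  by apply: (subspace_sum sG) => n _ _; case: (sG) => _ _; exact.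
apply/closure_absvP => e e0; have [n [w Ww Kxw]] := minima_exhaust Gx.
have [_ _ lnet /(_ _ e0)[N lNe]] := Kl; have [u Vu xwu] := lnet N _ Kxw.
have sspan := subspace_span_family iota J two_sided.
exists (w + u); last by rewrite opprD addrA; exact: le_lt_trans lNe.
case: (sspan) => _ + _; apply.
  by apply: initspan_sub Ww => // i _; exact: (spants (Negz i)).
by apply: initspan_sub Vu => // i _; exact: (spants (Posz i)).
Qed.

(** Passes from positive parts to signed valuations: as [absv (l n) <= r], they differ by at most
    [M], the total weight is at most 2, and the term of index 0, absent here, is finite. *)
Lemma two_sided_series : (forall n, l n != 0) ->
  (\sum_(1 <= n < N | n%:Z \in J) v (two_sided n%:Z) * (q ^- n)%:E)%E
    @[N --> \oo] --> +oo%E.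
Proof.
move=> l0; pose b n := - ln (absv (l n)); pose M := Num.max 0 (ln r).
have vE n : v (l n) = (b n)%:E by exact: valuationE.
have vposE n : (v^\+ (l n))%E = (Num.max (b n) 0)%:E.
  by rewrite funeposE vE EFin_max.
have M0 : 0 <= M by rewrite le_max lexx.
have bM n : Num.max (b n) 0 <= b n + M.
  rewrite ge_max lerDl M0/= /b addrC subr_ge0 le_max; apply/orP; right.
  by rewrite ler_ln ?posrE ?absv_gt0//; have [/(_ n)[]] := Kl.
have : (\sum_(0 <= n < N) v^\+ (l n) * (q ^- n)%:E)%E @[N --> \oo] --> +oo%E.
  rewrite -lser; apply: is_cvg_nneseries => n _ _.
  by rewrite mule_ge0// lee_fin.
move=> /cvgeyPge cvgl; apply/cvgeyPge => A.
have [N0 _ N0P] := cvgl (A + Num.max (b 0%N) 0 + M * 2).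
exists N0.+1 => // -[//|N] /= N0N.
have := N0P N.+1 (ltnW N0N).
have -> : (\sum_(0 <= n < N.+1) v^\+ (l n) * (q ^- n)%:E)%E =
    (\sum_(0 <= n < N.+1) Num.max (b n) 0 * q ^- n)%:E.
  by rewrite -sumEFin; apply: eq_bigr => n _; rewrite vposE EFinM.
rewrite lee_fin big_ltn// expr0 invr1 mulr1 => h.
have -> : (\sum_(1 <= n < N.+1 | n%:Z \in J) v (l n) * (q ^- n)%:E)%E =
    (\sum_(1 <= n < N.+1) b n * q ^- n)%:E.
  rewrite -sumEFin; apply: eq_big => [n|n _]; last by rewrite /= vE EFinM.
  by rewrite mem_set//; exact: l0.
rewrite lee_fin.
have : \sum_(1 <= n < N.+1) Num.max (b n) 0 * q ^- n <=
    \sum_(1 <= n < N.+1) b n * q ^- n + M * \sum_(1 <= n < N.+1) q ^- n.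
  rewrite mulr_sumr -big_split/=; apply: ler_sum => n _.
  by rewrite -mulrDl ler_wpM2r.
have : M * \sum_(1 <= n < N.+1) q ^- n <= M * 2.
  rewrite ler_wpM2l// (le_trans _ (geometric_sum_le2 N.+1 (F := F)))//.
  by rewrite [leRHS]big_ltn// lerDr.
lra.
Qed.

Lemma two_sided_descending : is_descending_basis iota J two_sided G.
Proof.
have uniq_ge s c m : uniq s -> {in s, forall n, J n /\ n <= m} -> J m ->
    \sum_(n <- s) iota (c n) * two_sided n != 0 ->
    absv (two_sided m) <= absv (\sum_(n <- s) iota (c n) * two_sided n).
  move=> us sJ Jm; case: (pselect (exists2 n, n \in s & c n != 0)).
    by move=> [n ns cn] _; exact: two_sided_ge ns cn.
  move=> nc; rewrite big1_seq ?eqxx// => n /andP[_ ns].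
  have [->|cn] := eqVneq (c n) 0; first by rewrite rmorph0 mul0r.
  by exfalso; apply: nc; exists n.
split.
- move=> m n k Jm Jk /andP[mn nk]; case: n mn nk => [n|n] mn nk; rewrite /J/=.
    by case: k Jk nk => [k|//] Jk nk; exact: reduced_neq0 Jk.
  case: m Jm mn => [//|m] Jm; rewrite !NegzE lerN2 lez_nat ltnS => nm.
  exact: minima_neq0 Jm.
- split; last exact: two_sided_closure.
  move=> s c us sJ sum0 n ns; apply/eqP/negPn/negP => cn.
  have [m ms mmax] := seq_int_max ns; have Jm := sJ _ ms.
  have := two_sided_ge us (fun k ks => conj (sJ k ks) (mmax k ks)) Jm ns cn.
  by rewrite sum0 absv0 leNgt absv_gt0 Jm.
- move=> m Jm; split => // x /span_family_uniq[s [c [us sJ ->]]].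
  exact: uniq_ge.
- have [[k muk]|/forallNP mu0] := pselect (exists k, mu k = 0).
    left; exists (Negz k) => -[//|n] Jn; rewrite !NegzE lerN2 lez_nat ltnS leqNgt.
    by apply/negP => /ltnW/minima_neq0/(_ Jn); rewrite muk eqxx.
  right; have {}mu0 n : mu n != 0 by apply/eqP.
  apply/cvgryPge => A; have [n An] := minima_unbounded A mu0.
  exists n.+1 => // -[//|k] /= nk.
  by rewrite (le_trans (ltW An))// minima_nondecr.
- have [[k lk]|/forallNP l0] := pselect (exists k, l k = 0).
    left; exists k%:Z => -[n|//] Jn; rewrite lez_nat leqNgt.
    by apply/negP => /ltnW/reduced_neq0/(_ Jn); rewrite lk eqxx.
  by right; apply: two_sided_series => n; apply/eqP.
Qed.

End Basis.

Lemma reduced_has_descending_basis : has_descending_basis iota G.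
Proof.
have [mu muP] := successive_minima.
exists [set n | two_sided mu n != 0], (two_sided mu).
by apply: two_sided_descending => n; case: (muP n).
Qed.

End ReducedToDescending.

(** * Independence of the radius, local compactness, special cases and subspaces *)

Section Consequences.
Context {R : realType} {C : fieldType} {a : nonarch_absval R C}.
Local Notation Ca := (valued a).
Local Notation v := (@valuation R C a).
Context {F : finFieldType} (iota : {rmorphism F -> Ca}).
Implicit Types (x : Ca) (r s t : R) (K G H : set Ca).

Lemma has_descending_basisP r G : is_complete a -> 0 < r -> is_subspace iota G ->
  has_descending_basis iota G <-> scriptG iota r G.
Proof.
move=> cpl r0 sG; split => [[J [lam basis]]|].
  exact: (descending_scriptG sG basis).
move=> /(scriptGP r0 sG)[cG intG]; have sK := subspace_GDelta r0 sG.
have [l Kl] := reduced_basis_exists (cG r) sK.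
have := (valuation_integral_infiniteP (cG r) sK Kl).1 intG.
exact: (reduced_has_descending_basis r0 sG cG Kl).
Qed.

Lemma scriptG_radius s t G : is_complete a -> is_subspace iota G ->
  0 < s -> 0 < t -> scriptG iota s G <-> scriptG iota t G.
Proof.
move=> cpl sG s0 t0.
by rewrite -(has_descending_basisP cpl s0 sG) (has_descending_basisP cpl t0 sG).
Qed.

Lemma scriptG_locally_compact r G : 0 < r -> scriptG iota r G ->
  is_locally_compact G.
Proof.
move=> r0 Gr x _; have [sG cG _ _] := Gr.
have Gval (z : G) : G (set_val z) by exact: set_valP.
have Gx := Gval x.
(* Its trace on [G] is a translate of G cap Delta_r, hence compact. *)
pose B : set Ca := [set y | absv (y - set_val x) <= r].
have cB : compact (G `&` B).
  rewrite (_ : G `&` B = [set set_val x + y | y in G `&` Delta r]).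
    exact: compact_translate.
  rewrite image_translate; apply/seteqP; split => y [Gy yB]; split => //.
    exact: (subspaceB sG).
  rewrite -(subrK (set_val x) y); case: sG => _ + _; exact.
have cval : continuous (set_val : G -> Ca) by exact: initial_continuous.
exists (set_val @^-1` B).
  have nB : nbhs x (set_val @^-1` B).
    apply: (cval x); apply/nbhs_absvP; exists r => // y xy.
    by rewrite /B/= absvBC ltW.
  by apply: filterS nB => z zB _.
split; last first.
  by apply: closed_comp => //; exact: absv_le_closed.
(* The filter on the subtype is pushed forward to the field; its cluster point there lies in [G] and
   is pulled back. *)
move=> Phi PhiF PhiB.
have PhiGB : Phi (set_val @^-1` (G `&` B)).
  by apply: filterS PhiB => z zB; split; [exact: (Gval z)|exact: zB].
have [y [[Gy yB] ycl]] := cB (set_val @ Phi) _ PhiGB.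
exists (exist _ y (mem_set Gy)); split => // A W PhiA.
move=> [_ [[V oV <-] /= Vy VW]].
have [||_ [[z Az <-] Vz]] := ycl (set_val @` A) V; last by exists z; split => //; exact: VW.
  have : Phi (set_val @^-1` (set_val @` A)) by apply: filterS PhiA => z Az; exists z.
  exact.
exact: open_nbhs_nbhs.
Qed.

(** The zero sequence is a reduced basis of the origin, and the terms of its series are infinite. *)
Lemma valuation_integral_infinite_point :
  valuation_integral_infinite ([set 0] : set Ca).
Proof.
have s0 : is_subspace iota [set 0].
  by split => [//|x y -> ->|u x ->] /=; rewrite ?addr0 ?mulr0.
apply/(valuation_integral_infiniteP (l := fun=> 0) _ s0); first exact: compact_set1.
  split => [//|n w _|n x ->|e e0]; last by exists 0%N; rewrite absv0.
    by rewrite absv0 absv_ge0.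
  by exists 0; [case: (subspace_initspan iota (fun=> 0) n)|rewrite subr0 absv0].
apply: (nneseries_pinfty (k := 0%N)) => // [n _|].
  by rewrite mule_ge0// lee_fin.
by rewrite valuation_pos0 expr0 invr1 mule1.
Qed.

(** The radius may be changed to an [s] for which G cap Delta_s is reduced to 0. Cosets are then
    points, and systems of representatives are enumerations of [G]. *)
Lemma scriptG_discrete r G : is_complete a -> 0 < r -> is_subspace iota G ->
  is_discrete G -> scriptG iota r G <->
  finite_set G \/ ((G #= [set: nat])%card /\
    forall g : nat -> Ca, set_bij [set: nat] G g -> tends_to_infty g).
Proof.
move=> cpl r0 sG dG; have [G0 _ _] := sG.
have [s s0 Gs] : exists2 s, 0 < s & G `&` Delta s = [set 0].
  have [_ [V /nbhs_absvP[e e0 eV] VG]] := dG _ G0.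
  exists (e / 2); first by rewrite divr_gt0.
  apply/seteqP; split => [y [Gy ye]|_ ->]; last first.
    by split => //; rewrite /Delta/= absv0 divr_ge0// ltW.
  suff : (V `&` G) y by rewrite VG.
  split => //; apply: eV; rewrite sub0r absvN (le_lt_trans ye)//.
  by rewrite ltr_pdivrMr// ltr_pMr// ltr1n.
rewrite (scriptG_radius cpl sG r0 s0).
have s0G : is_subspace iota [set 0] by rewrite -Gs; exact: subspace_GDelta.
have cosetsG : (cosets [set 0] G #= G)%card.
  apply: inj_card_eq => x y _ _ /(coset_mem s0G)/eqP.
  by rewrite subr_eq0 => /eqP.
have repG g : coset_representatives [set 0] G g <-> set_bij [set: nat] G g.
  split => [[Gg rep]|[Gg ginj gsurj]].
    split => [n _//|m n _ _ gmn|x Gx].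
      have [k [_ kuniq]] := rep _ (Gg m).
      transitivity k; [apply/esym|]; apply: kuniq => /=; first by rewrite subrr.
      by rewrite gmn subrr.
    by have [n [/eqP + _]] := rep _ Gx; rewrite subr_eq0 => /eqP ->; exists n.
  split => [n|x Gx]; first exact: Gg.
  have [n _ gn] := gsurj _ Gx; exists n; split => [|m /eqP] /=.
    by rewrite gn subrr.
  by rewrite subr_eq0 -gn => /eqP /ginj; apply; rewrite inE.
rewrite /scriptG/= Gs (eq_finite_set cosetsG); split.
  move=> [_ _ _ [fin|[cnt tend]]]; [by left|right; split].
    by rewrite (card_eq_trans _ cnt)// card_eq_sym.
  by move=> g /repG; exact: tend.
move=> h; split => //; [exact: compact_set1|exact: valuation_integral_infinite_point|].
case: h => [fin|[cnt tend]]; [by left|right; split].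
  exact: card_eq_trans cnt.
by move=> g /repG; exact: tend.
Qed.

Lemma scriptG_of_compact r G : is_complete a -> 0 < r -> is_subspace iota G ->
  compact G -> scriptG iota r G <-> valuation_integral_infinite G.
Proof.
move=> cpl r0 sG cG; have [t t0 Gt] := compact_bounded_Delta cG.
rewrite (scriptG_radius cpl sG r0 t0) (scriptGP t0 sG) (setIidl Gt).
split => [[]//|intG]; split => // u; apply: compact_closedI => //.
exact: closed_Delta.
Qed.

Lemma scriptG_closed_subspace r G H : 0 < r -> is_subspace iota G ->
  scriptG iota r G -> is_subspace iota H -> H `<=` G ->
  @closed (subspace G) H -> scriptG iota r H.
Proof.
move=> r0 sG /(scriptGP r0 sG)[cG intG] sH HG clH.
have cH t : compact (H `&` Delta t).
  (* [H] is closed relative to [G]: its balls are cut out of the compact balls of [G] by a closed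
     set [V] with the same trace on [G]. *)
  have [V clV VG] := (closed_subspaceP G H).1 clH.
  rewrite (_ : H `&` Delta t = (G `&` Delta t) `&` V).
    exact: compact_closedI.
  rewrite setIAC; congr (_ `&` _); rewrite setIC VG; exact/esym/setIidl.
apply/(scriptGP r0 sH); split => //.
have sGr := subspace_GDelta r0 sG; have sHr := subspace_GDelta r0 sH.
have [l Gl] := reduced_basis_exists (cG r) sGr.
have [m Hm] := reduced_basis_exists (cH r) sHr.
apply/(valuation_integral_infiniteP (cH r) sHr Hm)/eqP; rewrite -leye_eq.
rewrite -((valuation_integral_infiniteP (cG r) sGr Gl).1 intG).
apply: lee_nneseries => [n _ _|n _]; first by rewrite mule_ge0// lee_fin.
rewrite lee_wpmul2r ?lee_fin//; apply: valuation_pos_le.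
apply: (reduced_basis_le (iota := iota) (K := H `&` Delta r)
  (L := G `&` Delta r)) => //.
exact: setSI.
Qed.

End Consequences.

Theorem proposition4p3 (R : realType) (F : finFieldType)
    (C : fieldType) (closedC : GRing.closed_field_axiom C)
    (a : nonarch_absval R C) (complete_a : is_complete a)
    (iota : {rmorphism F -> valued a}) (r : R) (r_gt0 : 0 < r)
    (G : set (valued a)) (subG : is_subspace iota G) :
  (forall s t : R, 0 < s -> 0 < t -> (scriptG iota s G <-> scriptG iota t G))
  /\ (has_descending_basis iota G <-> scriptG iota r G)
  /\ (scriptG iota r G -> is_locally_compact G)
  /\ (is_discrete G ->
        (scriptG iota r G <->
           finite_set G \/
           ((G #= [set: nat])%card /\
            forall g : nat -> valued a,
              set_bij [set: nat] G g -> tends_to_infty g)))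
  /\ (compact G -> (scriptG iota r G <-> valuation_integral_infinite G))
  /\ (scriptG iota r G ->
        forall H : set (valued a), is_subspace iota H -> H `<=` G ->
          @closed (subspace G) H -> scriptG iota r H).
Proof.
split; first by move=> s t s0 t0; exact: scriptG_radius.
split; first exact: has_descending_basisP.
split; first exact: scriptG_locally_compact.
split; first exact: scriptG_discrete.
split; first exact: scriptG_of_compact.
by move=> Gr H; exact: scriptG_closed_subspace Gr.
Qed.
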